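(* There is an algorithm which, given a positive integer $e$, a prime $p$, a finite $e$-generated group $H$ described by a finite presentation, a simple $\mathbb{Z}_pH$-module $V$, and a basis of $H^2(H,V)$ (represented by $2$-cocycles in $Z^2(H,V)$), constructs the $(V,e)$-cover $\hat H_{V,e}$ of $H$.
   Context: $\mathbb{Z}_p$ denotes the integers modulo $p$; modules are finite-dimensional right modules. A group is $e$-generated if it can be generated by $e$ elements. A $\mathbb{Z}_pH$-module is $V$-homogeneous if it is a direct sum of finitely many (possibly zero) copies of $V$. The $(V,e)$-cover: let $F$ be free of rank $e$, let $\psi\colon F\to H$ be an epimorphism with kernel $M$, and let $M_p=[M,M]M^{[p]}$, where $M^{[p]}$ is the subgroup generated by all $p$-th powers of elements of $M$. Then $M/M_p$ is a $\mathbb{Z}_pH$-module (with $g\in H$ acting by conjugation by any $\psi$-preimage of $g$). For a $\mathbb{Z}_pH$-module $A$ let $V(A)$ be the smallest submodule of $A$ such that $A/V(A)$ is $V$-homogeneous. Put $\hat H_{p,e}=F/M_p$ and $\hat H_{V,e}=\hat H_{p,e}/V(M/M_p)$; it is the largest $e$-generated group that maps onto $H$ with $V$-homogeneous kernel, and up to isomorphism it does not depend on $\psi$. $Z^2(H,V)$ and $H^2(H,V)$ are the groups of $2$-cocycles and second cohomology, regarded as $\mathbb{Z}_p$-vector spaces. The module $V$ is given by matrices over $\mathbb{Z}_p$ for the generators of $H$. *)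

(* Defs.v *)
From HB Require Import structures.
From mathcomp Require Import all_boot all_order all_fingroup all_algebra.
From mathcomp Require Import mxrepresentation.
From mathcomp Require Import boolp classical_sets functions.

Set Implicit Arguments.
Unset Strict Implicit.
Unset Printing Implicit Defensive.

Import GroupScope GRing.Theory.

Local Open Scope classical_set_scope.
Local Open Scope group_scope.

(* [(i, false)] stands for the i-th generator and [(i, true)] for its
   inverse. *)
Definition letter n := ('I_n * bool)%type.
Definition word n := seq (letter n).

Definition weval n (G : groupType) (x : 'I_n -> G) (w : word n) : G :=
  \prod_(l <- w) (if l.2 then (x l.1)^-1 else x l.1).

Section FreeGroup.
Variable n : nat.
Implicit Types (l : letter n) (u v w : word n).

Definition linv l : letter n := (l.1, ~~ l.2).

Definition reduced w := sorted (fun a b => b != linv a) w.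

Definition push l w : word n :=
  if w is l' :: w' then if l' == linv l then w' else l :: w else [:: l].

Definition wmul u v : word n := foldr push v u.
Definition winv w : word n := rev (map linv w).

Lemma linvK : involutive linv.
Proof. by case=> i b; rewrite /linv /= negbK. Qed.

Lemma reduced_behead l w : reduced (l :: w) -> reduced w.
Proof. exact: path_sorted. Qed.

Lemma push_cons l w : reduced (l :: w) -> push l w = l :: w.
Proof. by case: w => //= l' w /andP[/negPf->]. Qed.

Lemma push_reduced l w : reduced w -> reduced (push l w).
Proof.
case: w => [|l' w] //= r; case: eqP => [_|/eqP ne] /=; last by rewrite ne.
exact: path_sorted r.
Qed.

Lemma pushK l w : reduced w -> push (linv l) (push l w) = w.
Proof.
case: w => [|l' w] r; first by rewrite /= linvK eqxx.
rewrite [push l _]/=; case: eqP => [e|_]; last by rewrite /= linvK eqxx.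
by rewrite -e push_cons.
Qed.

Lemma pushVK l w : reduced w -> push l (push (linv l) w) = w.
Proof. by move=> r; rewrite -{1}[l]linvK pushK. Qed.

Lemma wmul_reduced u v : reduced v -> reduced (wmul u v).
Proof. by move=> rv; elim: u => //= l u; apply: push_reduced. Qed.

Lemma wmul_push l v w :
  reduced v -> reduced w -> wmul (push l v) w = push l (wmul v w).
Proof.
case: v => [|l' v] //= _ rw; case: eqP => [->|//].
by rewrite pushVK // wmul_reduced.
Qed.

Lemma wmulA u v w :
  reduced v -> reduced w -> wmul u (wmul v w) = wmul (wmul u v) w.
Proof.
move=> rv rw; elim: u => //= l u ->.
by rewrite wmul_push // wmul_reduced.
Qed.

Lemma wmulw0 u : reduced u -> wmul u [::] = u.
Proof.
elim: u => //= l u IH r; rewrite IH; first exact: push_cons.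
exact: reduced_behead r.
Qed.

Lemma wmul_cat u v w : wmul (u ++ v) w = wmul u (wmul v w).
Proof. exact: foldr_cat. Qed.

Lemma winv_reduced w : reduced w -> reduced (winv w).
Proof.
rewrite /reduced /winv rev_sorted sorted_map; apply: sub_sorted => a b /=.
by rewrite linvK; apply: contraNneq => <-.
Qed.

Lemma winvK : involutive winv.
Proof. by move=> w; rewrite /winv map_rev revK mapK //; apply: linvK. Qed.

Lemma wmulVw w : reduced w -> wmul (winv w) w = [::].
Proof.
rewrite /winv; elim: w => //= l w IH r.
rewrite rev_cons -cats1 wmul_cat /= linvK eqxx; apply: IH.
exact: reduced_behead r.
Qed.

(* The reduced words form the free group on the one-letter words. *)
Record free_group := Free { fword :> word n; _ : reduced fword }.
HB.instance Definition _ := [isSub for fword].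
HB.instance Definition _ := [Choice of free_group by <:].

Definition free1 : free_group := @Free [::] isT.
Definition free_mul (a b : free_group) : free_group :=
  Free (wmul_reduced (fword a) (valP b)).
Definition free_inv (a : free_group) : free_group := Free (winv_reduced (valP a)).

Lemma free_mulA : associative free_mul.
Proof. by move=> a b c; apply/val_inj/wmulA; exact: valP. Qed.
Lemma free_mul1g : left_id free1 free_mul.
Proof. by move=> a; apply: val_inj. Qed.
Lemma free_mulg1 : right_id free1 free_mul.
Proof. by move=> a; apply/val_inj/wmulw0; exact: valP. Qed.
Lemma free_mulVg : left_inverse free1 free_inv free_mul.
Proof. by move=> a; apply/val_inj/wmulVw; exact: valP. Qed.
Lemma free_mulgV : right_inverse free1 free_inv free_mul.
Proof.
move=> a; apply: val_inj => /=; rewrite -{1}[fword a]winvK.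
by apply: wmulVw; exact: winv_reduced (valP a).
Qed.

HB.instance Definition _ :=
  isGroup.Build free_group free_mulA free_mul1g free_mulg1 free_mulVg free_mulgV.

Definition fgen (i : 'I_n) : free_group := @Free [:: (i, false)] isT.

End FreeGroup.

Section Subgroups.
Variable G : groupType.

Definition is_subgroup (A : set G) : Prop :=
  A 1 /\ forall x y, A x -> A y -> A (x * y^-1).

Definition is_normal_subgroup (A : set G) : Prop :=
  is_subgroup A /\ forall x y, A x -> A (x ^ y).

Definition gen_subgroup (A : set G) : set G := smallest is_subgroup A.
Definition normal_closure (A : set G) : set G := smallest is_normal_subgroup A.

Lemma normal_closureP A : is_normal_subgroup (normal_closure A).
Proof.
split; [split|].
- by move=> N [[[]]].
- move=> x y hx hy N /[dup] -[[[_ h] _] _] hN; exact: h (hx _ hN) (hy _ hN).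
- by move=> x y hx N /[dup] -[[_ h] _] hN; apply: h (hx _ hN).
Qed.

End Subgroups.

Section Quotient.
Variables (G : groupType) (A : set G).
Let N := normal_closure A.

Let N1 : N 1. Proof. by case: (normal_closureP A) => -[]. Qed.
Let NF x y : N x -> N y -> N (x * y^-1).
Proof. by case: (normal_closureP A) => -[_ h] _; exact: h. Qed.
Let NJ x y : N x -> N (x ^ y).
Proof. by case: (normal_closureP A) => _; exact. Qed.
Let NV x : N x -> N x^-1. Proof. by move/(NF N1); rewrite mul1g. Qed.
Let NM x y : N x -> N y -> N (x * y).
Proof. by move=> hx /NV/(NF hx); rewrite invgK. Qed.

Definition quot_rel (x y : G) : bool := `[< N (x^-1 * y) >].

Lemma quot_rel_refl : reflexive quot_rel.
Proof. by move=> x; apply/asboolP; rewrite mulVg. Qed.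
Lemma quot_rel_sym : symmetric quot_rel.
Proof.
by move=> x y; apply/asboolP/asboolP => /NV; rewrite invgM invgK.
Qed.
Lemma quot_rel_trans : transitive quot_rel.
Proof.
move=> y x z /asboolP hxy /asboolP hyz; apply/asboolP.
by have := NM hxy hyz; rewrite -mulgA mulVKg.
Qed.

Canonical quot_equiv :=
  EquivRel quot_rel quot_rel_refl quot_rel_sym quot_rel_trans.

(* The quotient of [G] by the normal closure of [A]; it is [G / A] when [A]
   is a normal subgroup. *)
Definition quot : Type := {eq_quot quot_equiv}%qT.
HB.instance Definition _ := EqQuotient.on quot.
HB.instance Definition _ := Choice.on quot.

Definition qproj : G -> quot := \pi_quot%qT.

Definition quot_one : quot := qproj 1.
Definition quot_mul (a b : quot) : quot := qproj (generic_quotient.repr a * generic_quotient.repr b).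
Definition quot_inv (a : quot) : quot := qproj (generic_quotient.repr a)^-1.

Lemma qprojE x y : (qproj x = qproj y) <-> N (x^-1 * y).
Proof. by split=> [/eqmodP/asboolP|h] //; apply/eqmodP/asboolP. Qed.

Lemma qproj_repr a : qproj (generic_quotient.repr a) = a. Proof. exact: reprK. Qed.

Lemma quot_mulE x y : quot_mul (qproj x) (qproj y) = qproj (x * y).
Proof.
apply/qprojE; have /qprojE hx := qproj_repr (qproj x).
have /qprojE hy := qproj_repr (qproj y).
have := NM (NJ (generic_quotient.repr (qproj y)) hx) hy.
by rewrite /conjg invgM !mulgA mulgK.
Qed.

Lemma quot_invE x : quot_inv (qproj x) = qproj x^-1.
Proof.
apply/qprojE; have /qprojE/NV/(NJ x^-1) := qproj_repr (qproj x).
by rewrite /conjg invgM !invgK mulgA mulVKg.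
Qed.

Lemma quot_mulA : associative quot_mul.
Proof.
move=> a b c; rewrite -(qproj_repr a) -(qproj_repr b) -(qproj_repr c).
by rewrite !quot_mulE mulgA.
Qed.
Lemma quot_mul1g : left_id quot_one quot_mul.
Proof. by move=> a; rewrite -(qproj_repr a) quot_mulE mul1g. Qed.
Lemma quot_mulg1 : right_id quot_one quot_mul.
Proof. by move=> a; rewrite -(qproj_repr a) quot_mulE mulg1. Qed.
Lemma quot_mulVg : left_inverse quot_one quot_inv quot_mul.
Proof.
by move=> a; rewrite -(qproj_repr a) quot_invE quot_mulE mulVg.
Qed.
Lemma quot_mulgV : right_inverse quot_one quot_inv quot_mul.
Proof.
by move=> a; rewrite -(qproj_repr a) quot_invE quot_mulE mulgV.
Qed.

HB.instance Definition _ :=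
  isGroup.Build quot quot_mulA quot_mul1g quot_mulg1 quot_mulVg quot_mulgV.

Lemma qprojM : {morph qproj : x y / x * y}.
Proof. by move=> x y; rewrite -quot_mulE. Qed.
HB.instance Definition _ := isMultiplicative.Build G quot qproj qprojM.

End Quotient.

Definition presentation := {n : nat & seq (word n)}.

(* The map from the free group sending the generators to [x] is onto [G], and
   its kernel is the normal closure of the relators. *)
Definition presents (G : groupType) n (x : 'I_n -> G) (R : seq (word n)) :
    Prop :=
  (forall g : G, exists w : word n, weval x w = g) /\
  (forall w : free_group n,
     weval x w = 1 <-> normal_closure [set weval (@fgen n) r | r in [set` R]] w).

Definition presents_group (P : presentation) (G : groupType) : Prop :=
  exists x : 'I_(tag P) -> G, presents x (tagged P).

Definition generated_by (e : nat) (gT : finGroupType) : Prop :=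
  exists t : 'I_e -> gT, <<[set t i | i : 'I_e]%SET>> = [set: gT]%SET.

Section Cohomology.
Variables (p d : nat) (gT : finGroupType).
Variable rV : mx_representation 'F_p [set: gT]%G d.
Local Open Scope ring_scope.

Definition cochain2 := {ffun gT * gT -> 'rV['F_p]_d}.

(* The conventions for right modules, with [v * g] written [v *m rV g]; cochains
   are not required to be normalized. *)
Definition cocycle2 (c : cochain2) : Prop :=
  forall g h k : gT,
    c ((g * h)%g, k) + c (g, h) *m rV k = c (g, (h * k)%g) + c (h, k).

Definition coboundary2 (c : cochain2) : Prop :=
  exists t : gT -> 'rV['F_p]_d,
    forall g h : gT, c (g, h) = t g *m rV h + t h - t (g * h)%g.

(* The classes of the cocycles [cs i] form a basis of [Z^2 / B^2]. *)
Definition H2_basis r (cs : 'I_r -> cochain2) : Prop :=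
  [/\ forall i, cocycle2 (cs i),
      forall a : 'I_r -> 'F_p,
        coboundary2 (\sum_i a i *: cs i) -> forall i, a i = 0
    & forall c, cocycle2 c ->
        exists a : 'I_r -> 'F_p, coboundary2 (c - \sum_i a i *: cs i)].

End Cohomology.

(* A cochain is written down as its graph, with elements of the group given by
   words in its generators. *)
Definition cochain_table n p d := seq (word n * word n * 'rV['F_p]_d).

Definition represents_cochain n p d (gT : finGroupType) (x : 'I_n -> gT)
    (t : cochain_table n p d) (c : cochain2 p d gT) : Prop :=
  (forall u v a, (u, v, a) \in t -> c (weval x u, weval x v) = a) /\
  (forall g h : gT, exists u v : word n,
     [/\ weval x u = g, weval x v = h & (u, v, c (g, h)) \in t]).

Section Cover.
Variables (p d e : nat) (gT : finGroupType).
Variable rV : mx_representation 'F_p [set: gT]%G d.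
Variable psi : {multiplicative free_group e -> gT}.

(* [B] is an abelian normal subgroup of [E] on which [psi f] acts as
   conjugation by [q f]; it is isomorphic to the direct sum of [k] copies of
   [V], that is, to the [k x d] matrices with [gT] acting on the rows. *)
Definition homogeneous (E : groupType) (q : free_group e -> E) (B : set E) : Prop :=
  exists k (theta : E -> 'M['F_p]_(k, d)),
    [/\ set_bij B setT theta,
        forall a b, B a -> B b -> theta (a * b) = (theta a + theta b)%R
      & forall a f, B a -> theta (a ^ q f) = (theta a *m rV (psi f))%R].

Definition cker : set (free_group e) := [set f | psi f = 1].

Definition cker_p : set (free_group e) :=
  [set a * b | a in gen_subgroup [set [~ x, y] | x in cker & y in cker]
             & b in gen_subgroup [set x ^+ p | x in cker]].

Definition pcover : groupType := quot cker_p.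
Definition to_pcover : free_group e -> pcover := qproj cker_p.

Definition pmodule : set pcover := to_pcover @` cker.

(* Being killed by [p], the module [pmodule] has as submodules its subgroups
   that are stable under the action. *)
Definition is_submodule (W : set pcover) : Prop :=
  [/\ is_subgroup W, W `<=` pmodule
    & forall a f, W a -> W (a ^ to_pcover f)].

Definition homogeneous_quotient (W : set pcover) : Prop :=
  is_submodule W /\
  homogeneous (qproj W \o to_pcover) (qproj W @` pmodule).

Definition Vradical : set pcover := smallest homogeneous_quotient set0.

Definition Vcover : groupType := quot Vradical.

End Cover.

Inductive data := Leaf | Node of data & data.

Inductive prog :=
  | PId
  | PLeaf
  | PNode of prog & prog
  | PLeft
  | PRight
  | PSeq of prog & prog
  | PIf of prog & prog & prog
  | PWhile of prog & prog.

(* [eval P s t]: started on [s], the while-program [P] over binary trees halts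
   with result [t]. A test succeeds when its value is not [Leaf]. *)
Inductive eval : prog -> data -> data -> Prop :=
  | EId s : eval PId s s
  | ELeaf s : eval PLeaf s Leaf
  | ENode P Q s a b : eval P s a -> eval Q s b -> eval (PNode P Q) s (Node a b)
  | ELeftL : eval PLeft Leaf Leaf
  | ELeftN a b : eval PLeft (Node a b) a
  | ERightL : eval PRight Leaf Leaf
  | ERightN a b : eval PRight (Node a b) b
  | ESeq P Q s t u : eval P s t -> eval Q t u -> eval (PSeq P Q) s u
  | EIfT C P Q s a b t :
      eval C s (Node a b) -> eval P s t -> eval (PIf C P Q) s t
  | EIfF C P Q s t : eval C s Leaf -> eval Q s t -> eval (PIf C P Q) s t
  | EWhileT C P s a b t u :
      eval C s (Node a b) -> eval P s t -> eval (PWhile C P) t u ->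
      eval (PWhile C P) s u
  | EWhileF C P s : eval C s Leaf -> eval (PWhile C P) s s.

Lemma eval_functional P s t u : eval P s t -> eval P s u -> t = u.
Proof.
move=> h; elim: h u => {P s t}; do ?[by move=> *; match goal with
  | h : eval _ _ _ |- _ => inversion h end].
- move=> P Q s a b _ IH1 _ IH2 u h; inversion h; subst.
  by congr Node; [apply: IH1 | apply: IH2].
- move=> P Q s t v _ IH1 _ IH2 u h; inversion h; subst.
  by apply: IH2; rewrite (IH1 t0).
- move=> C P Q s a b t _ IH1 _ IH2 u h; inversion h; subst; first exact: IH2.
  by have := IH1 Leaf; move/(_ ltac:(assumption)).
- move=> C P Q s t _ IH1 _ IH2 u h; inversion h; subst; last exact: IH2.
  by have := IH1 (Node a b); move/(_ ltac:(assumption)).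
- move=> C P s a b t v _ IH1 _ IH2 _ IH3 u h; inversion h; subst.
    by apply: IH3; rewrite (IH2 t0).
  by have := IH1 Leaf; move/(_ ltac:(assumption)).
- move=> C P s _ IH1 u h; inversion h; subst => //.
  by have := IH1 (Node a b); move/(_ ltac:(assumption)).
Qed.

Definition enc_seq T (enc : T -> data) (s : seq T) : data :=
  foldr (fun x t => Node (enc x) t) Leaf s.

Definition enc_tuple (s : seq data) : data := enc_seq id s.

Definition enc_nat (n : nat) : data := enc_seq id (nseq n Leaf).

Definition enc_letter n (l : letter n) : data :=
  Node (enc_nat l.1) (enc_nat l.2).

Definition enc_word n (w : word n) : data := enc_seq (@enc_letter n) w.

Definition enc_presentation (P : presentation) : data :=
  Node (enc_nat (tag P)) (enc_seq (@enc_word (tag P)) (tagged P)).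

(* An element of ['F_p] is encoded through its representative below [p]. *)
Definition enc_mx p m n (A : 'M['F_p]_(m, n)) : data :=
  enc_seq (fun i => enc_seq (fun j => enc_nat (A i j)) (enum 'I_n))
    (enum 'I_m).

Definition enc_table n p d (t : cochain_table n p d) : data :=
  enc_seq (fun y => enc_tuple
    [:: enc_word y.1.1; enc_word y.1.2; enc_mx y.2]) t.

Definition enc_input (e p n : nat) (R : seq (word n)) (d : nat)
    (mats : 'I_n -> 'M['F_p]_d) (r : nat) (ts : 'I_r -> cochain_table n p d) :
    data :=
  enc_tuple
    [:: enc_nat e; enc_nat p; enc_presentation (Tagged (fun n => seq (word n)) R);
        enc_nat d; enc_seq (fun i => enc_mx (mats i)) (enum 'I_n);
        enc_seq (fun j => enc_table (ts j)) (enum 'I_r)].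

Arguments enc_input e p {n} R {d} mats {r} ts.

(* Main.v *)
From HB Require Import structures.
Require Import Defs.
From mathcomp Require Import all_boot all_order all_fingroup all_algebra.
From mathcomp Require Import mxrepresentation.
From mathcomp Require Import boolp classical_sets functions ring.

(* Let [c_1, .., c_r] be the given cocycles. On the product of [H] with a power
   of [V] having one coordinate for each [c_i] and one for each pair of a
   generator [y_j] and a basis vector [v_b], the family of cocycles
   [(c_1, .., c_r, 0, .., 0)] defines a finite group [X]. An epimorphism [psi]
   from the free group [F] lifts to [Psi : F -> X] by sending [y_j] to
   [psi y_j], with vector part [v_b] at the coordinate [(j, b)] and [0]
   elsewhere. Every [H]-homomorphism from [M = ker psi] to [V] extends to a
   derivation-like map of [F] twisted by a cocycle of [H]; as the [c_i] span
   [H^2], that map is, up to a function of [psi], a combination of the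
   coordinates of [Psi]. Hence [ker Psi] is the common kernel of the
   homomorphisms from [M] to [V], and since [V] is simple this is the kernel of
   [F -> Vcover]. By Gaschutz's lemma a generating tuple of [H] lifts to one of
   the image of [Psi], so that the image does not depend on [psi].

   The algorithm searches for a certificate: the table of the regular action of
   [H], derivations of its entries from the relators, words for an epimorphism
   [psi], and words proving that it is onto. It then has an explicit model of
   [X] and returns, as relators, all positive words of length at most [#|X|]
   that [Psi] kills. *)

Set Implicit Arguments.
Unset Strict Implicit.
Unset Printing Implicit Defensive.

(** * Functions computed by while-programs *)

(** Finiteness of [H] is only promised: no computable bound on its order can be read off the
    presentation. Hence the unbounded search, which halts because a certificate exists; what must be
    proved about the check is that every certificate it accepts leads to a correct answer. The cover
    is a quotient of an infinite group by an intersection of submodules. The proof avoids the module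
    [M/M_p]: an [H]-homomorphism from [M] to [V] is a function on all of [F], constrained on
    [ker psi] alone, and submodules are compared through common kernels of such functions. The
    coordinates [(j, b)] are there because, over the zero cocycle, a derivation of [F] may take
    arbitrary values at the generators: once the class in [H^2] is matched by the [c_i], these
    coordinates correct the values at the [y_j]. This also bounds the number of copies of [V] in the
    kernel of the cover by [r + e * d]. Cocycles are not normalized, so the identity of [X] is
    [(1, - c (1, 1))]. Derivations need not vanish at [1], and several formulas carry the
    corresponding shift. *)

Class codable (T : Type) := code : T -> data.

Instance data_codable : codable data := id.
(** With [tt] coded by [Leaf], right-nested pairs ending in [tt] have the code of an [enc_tuple];
    this is why the types of tables and inputs below end in [unit]. *)
Instance unit_codable : codable unit := fun=> Leaf.
Instance nat_codable : codable nat := enc_nat.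
Instance bool_codable : codable bool := fun b => enc_nat b.
Instance prod_codable (A B : Type) {cA : codable A} {cB : codable B} :
  codable (A * B) := fun x => Node (code x.1) (code x.2).
Instance seq_codable (A : Type) {cA : codable A} : codable (seq A) :=
  enc_seq code.

Definition computable {A B : Type} {cA : codable A} {cB : codable B}
    (f : A -> B) : Prop :=
  exists P, forall x, eval P (code x) (code (f x)).

Create HintDb computable discriminated.

Section Closure.
Context {A B C : Type} {cA : codable A} {cB : codable B} {cC : codable C}.

Lemma eval_const (c : data) : exists P, forall s, eval P s c.
Proof.
elim: c => [|a [P hP] b [Q hQ]]; first by exists PLeaf => t; constructor.
by exists (PNode P Q) => t; constructor.
Qed.

Lemma computable_const (b : B) : computable (fun _ : A => b).
Proof. by have [P hP] := eval_const (code b); exists P => x; apply: hP. Qed.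

Lemma computable_id : computable (fun x : A => x).
Proof. by exists PId => x; constructor. Qed.

Lemma computable_comp (g : B -> C) (f : A -> B) :
  computable g -> computable f -> computable (fun x => g (f x)).
Proof.
move=> [Q hQ] [P hP]; exists (PSeq P Q) => x; exact: ESeq (hP x) (hQ _).
Qed.

Lemma computable_pair (f : A -> B) (g : A -> C) :
  computable f -> computable g -> computable (fun x => (f x, g x)).
Proof.
move=> [P hP] [Q hQ]; exists (PNode P Q) => x; exact: ENode (hP x) (hQ x).
Qed.

Lemma computable_fst (f : A -> B * C) :
  computable f -> computable (fun x => (f x).1).
Proof.
move=> [P hP]; exists (PSeq P PLeft) => x; apply: ESeq (hP x) _; exact: ELeftN.
Qed.

Lemma computable_snd (f : A -> B * C) :
  computable f -> computable (fun x => (f x).2).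
Proof.
move=> [P hP]; exists (PSeq P PRight) => x; apply: ESeq (hP x) _; exact: ERightN.
Qed.

Lemma computable_if (b : A -> bool) (f g : A -> B) :
  computable b -> computable f -> computable g ->
  computable (fun x => if b x then f x else g x).
Proof.
move=> [P hP] [Q hQ] [R hR]; exists (PIf P Q R) => x; move: (hP x).
case: (b x) => h; [exact: EIfT h (hQ x)|exact: EIfF h (hR x)].
Qed.

Lemma computable_cons (f : A -> B) (g : A -> seq B) :
  computable f -> computable g -> computable (fun x => f x :: g x).
Proof.
move=> [P hP] [Q hQ]; exists (PNode P Q) => x; exact: ENode (hP x) (hQ x).
Qed.

Lemma computable_behead (f : A -> seq B) :
  computable f -> computable (fun x => behead (f x)).
Proof.
move=> [P hP]; exists (PSeq P PRight) => x; apply: ESeq (hP x) _.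
by case: (f x) => [|b s]; constructor.
Qed.

Lemma computable_head (b : B) (f : A -> seq B) :
  computable f -> computable (fun x => head b (f x)).
Proof.
move=> [P hP]; have [Q hQ] := eval_const (code b).
exists (PSeq P (PIf PId PLeft Q)) => x; apply: ESeq (hP x) _.
case: (f x) => [|c s]; first by apply: EIfF => //; constructor.
by apply: EIfT; constructor.
Qed.

(** Numbers are coded in unary, as lists of copies of [Leaf], so the same program serves. Iteration
    thereby becomes a fold over a list. *)
Lemma computable_nseq_tt (f : A -> nat) :
  computable f -> computable (fun x => nseq (f x) tt).
Proof.
move=> [P hP]; exists P => x; move: (hP x).
rewrite (_ : code (f x) = code (nseq (f x) tt)) //.
by rewrite /code /= /nat_codable /enc_nat; elim: (f x) => //= n ->.
Qed.

Lemma computable_succ (f : A -> nat) :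
  computable f -> computable (fun x => (f x).+1).
Proof.
by move=> [P hP]; exists (PNode PLeaf P) => x; constructor; [constructor|].
Qed.

Lemma computable_pred (f : A -> nat) :
  computable f -> computable (fun x => (f x).-1).
Proof.
move=> [P hP]; exists (PSeq P PRight) => x; apply: ESeq (hP x) _.
by case: (f x) => [|b]; constructor.
Qed.

Lemma computable_posn (f : A -> nat) :
  computable f -> computable (fun x => 0 < f x)%N.
Proof.
move=> [P hP]; exists (PSeq P (PIf PId (PNode PLeaf PLeaf) PLeaf)) => x.
apply: ESeq (hP x) _; case: (f x) => [|b].
  by apply: EIfF; constructor.
by apply: EIfT; [constructor | constructor; constructor].
Qed.

(* The state of the loop is [(x, (accumulator, rest of the list))]. *)
Lemma computable_foldl (f : A -> C -> B -> C) (i : A -> C) (l : A -> seq B) :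
  computable (fun z : A * C * B => f z.1.1 z.1.2 z.2) ->
  computable i -> computable l ->
  computable (fun x => foldl (f x) (i x) (l x)).
Proof.
move=> [P hP] [Q hQ] [R hR].
pose body := PNode PLeft (PNode
  (PSeq (PNode (PNode PLeft (PSeq PRight PLeft))
                (PSeq PRight (PSeq PRight PLeft))) P)
  (PSeq PRight (PSeq PRight PRight))).
exists (PSeq (PNode PId (PNode Q R))
   (PSeq (PWhile (PSeq PRight PRight) body) (PSeq PRight PLeft))) => x.
apply: ESeq (ENode (EId _) (ENode (hQ x) (hR x))) _.
move: (i x) (l x) => c s; apply: (@ESeq _ _ _
  (Node (code x) (Node (code (foldl (f x) c s)) Leaf))); last first.
  by apply: ESeq (ERightN _ _) (ELeftN _ _).
elim: s c => [|b s IH] c /=.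
  by apply: EWhileF; apply: ESeq (ERightN _ _) (ERightN _ _).
apply: EWhileT (IH _).
  by apply: ESeq (ERightN _ _) (ERightN _ _).
apply: ENode (ELeftN _ _) (ENode _ _).
  apply: ESeq; last exact: (hP ((x, c), b)).
  apply: ENode; first apply: ENode (ELeftN _ _) (ESeq (ERightN _ _) (ELeftN _ _)).
  by apply: ESeq (ERightN _ _) (ESeq (ERightN _ _) (ELeftN _ _)).
by apply: ESeq (ERightN _ _) (ESeq (ERightN _ _) (ERightN _ _)).
Qed.

Lemma computable_ext (f g : A -> B) : f =1 g -> computable f -> computable g.
Proof. by move=> e [P hP]; exists P => x; rewrite -e. Qed.

End Closure.

Lemma computable_eta (A B : Type) {cA : codable A} {cB : codable B}
  (f : A -> B) : computable (fun x => f x) -> computable f.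
Proof. by []. Qed.

(** Each hint matches the head symbol under the abstraction, so the search follows the syntax of the
    function and assembles its program along the way. *)
Ltac computable := typeclasses eauto 200 with computable.

#[global] Hint Opaque computable : computable.
#[global] Hint Extern 0 (computable (fun _ => ?c)) =>
  exact (computable_const c) : computable.
#[global] Hint Extern 0 (computable (fun x => x)) =>
  exact computable_id : computable.
#[global] Hint Extern 9 (computable ?f) =>
  lazymatch f with fun _ => _ => fail | _ => refine (computable_eta _) end
  : computable.
#[global] Hint Extern 0 (computable _) =>
  match goal with h : computable ?f |- computable (fun x => ?f _) =>
    refine (computable_comp h _) end : computable.
#[global] Hint Extern 1 (computable (fun x => (_, _))) =>
  refine (computable_pair _ _) : computable.
#[global] Hint Extern 1 (computable (fun x => fst _)) =>
  refine (computable_fst _) : computable.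
#[global] Hint Extern 1 (computable (fun x => snd _)) =>
  refine (computable_snd _) : computable.
#[global] Hint Extern 1 (computable (fun x => if _ then _ else _)) =>
  refine (computable_if _ _ _) : computable.
#[global] Hint Extern 1 (computable (fun x => _ :: _)) =>
  refine (computable_cons _ _) : computable.
#[global] Hint Extern 1 (computable (fun x => behead _)) =>
  refine (computable_behead _) : computable.
#[global] Hint Extern 1 (computable (fun x => head _ _)) =>
  refine (computable_head _ _) : computable.
#[global] Hint Extern 1 (computable (fun x => nseq _ tt)) =>
  refine (computable_nseq_tt _) : computable.
#[global] Hint Extern 1 (computable (fun x => S _)) =>
  refine (computable_succ _) : computable.
#[global] Hint Extern 1 (computable (fun x => predn _)) =>
  refine (computable_pred _) : computable.
#[global] Hint Extern 1 (computable (fun x => foldl _ _ _)) =>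
  refine (computable_foldl _ _ _) : computable.

Section Arithmetic.
Context {A : Type} {cA : codable A}.

Lemma foldl_nseq (T S : Type) (g : T -> T) (n : nat) (s : S) (z : T) :
  foldl (fun t _ => g t) z (nseq n s) = iter n g z.
Proof. by elim: n z => //= n IH z; rewrite IH -iterSr. Qed.

Lemma computable_iter {B : Type} {cB : codable B} (f : A -> B -> B)
    (n : A -> nat) (i : A -> B) :
  computable (fun z : A * B => f z.1 z.2) -> computable n -> computable i ->
  computable (fun x => iter (n x) (f x) (i x)).
Proof.
move=> hf hn hi.
apply: (computable_ext (f := fun x => foldl (fun t _ => f x t) (i x) (nseq (n x) tt))).
  by move=> x; rewrite foldl_nseq.
apply: computable_foldl => //; last by computable.
apply: (computable_comp (g := fun z : A * B => f z.1 z.2)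
         (f := fun z : A * B * unit => (z.1.1, z.1.2))) => //.
by computable.
Qed.

Variables m n : A -> nat.
Hypotheses (hm : computable m) (hn : computable n).

Lemma computable_addn : computable (fun x => m x + n x)%N.
Proof.
apply: (computable_ext (f := fun x => iter (m x) S (n x))).
  by move=> x; rewrite iter_succn addnC.
by apply: computable_iter => //; computable.
Qed.

Lemma computable_subn : computable (fun x => m x - n x)%N.
Proof.
apply: (computable_ext (f := fun x => iter (n x) predn (m x))).
  by move=> x; rewrite iter_predn.
by apply: computable_iter => //; computable.
Qed.

End Arithmetic.

#[global] Hint Extern 1 (computable (fun x => iter _ _ _)) =>
  refine (computable_iter _ _ _) : computable.
#[global] Hint Extern 1 (computable (fun x => addn _ _)) =>
  refine (computable_addn _ _) : computable.
#[global] Hint Extern 1 (computable (fun x => subn _ _)) =>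
  refine (computable_subn _ _) : computable.

Section Arithmetic2.
Context {A : Type} {cA : codable A}.
Variables m n : A -> nat.
Hypotheses (hm : computable m) (hn : computable n).

Lemma computable_muln : computable (fun x => m x * n x)%N.
Proof.
apply: (computable_ext (f := fun x => iter (m x) (addn (n x)) 0)).
  by move=> x; rewrite iter_addn_0 mulnC.
by computable.
Qed.

Lemma computable_leq : computable (fun x => m x <= n x)%N.
Proof.
apply: (computable_ext (f := fun x => if (0 < m x - n x)%N then false else true)).
  by move=> x; rewrite subn_gt0; case: ltnP.
apply: computable_if; first apply: computable_posn; computable.
Qed.

End Arithmetic2.

#[global] Hint Extern 1 (computable (fun x => muln _ _)) =>
  refine (computable_muln _ _) : computable.
#[global] Hint Extern 1 (computable (fun x => leq _ _)) =>
  refine (computable_leq _ _) : computable.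

Section Booleans.
Context {A : Type} {cA : codable A}.
Variables b c : A -> bool.
Hypotheses (hb : computable b) (hc : computable c).

Lemma computable_negb : computable (fun x => ~~ b x).
Proof.
apply: (computable_ext (f := fun x => if b x then false else true)) => //.
by computable.
Qed.
Lemma computable_andb : computable (fun x => b x && c x).
Proof. by rewrite /andb; computable. Qed.
Lemma computable_orb : computable (fun x => b x || c x).
Proof. by rewrite /orb; computable. Qed.
End Booleans.

#[global] Hint Extern 1 (computable (fun x => negb _)) =>
  refine (computable_negb _) : computable.
#[global] Hint Extern 1 (computable (fun x => andb _ _)) =>
  refine (computable_andb _ _) : computable.
#[global] Hint Extern 1 (computable (fun x => orb _ _)) =>
  refine (computable_orb _ _) : computable.

Section Arithmetic3.
Context {A : Type} {cA : codable A}.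
Variables m n : A -> nat.
Hypotheses (hm : computable m) (hn : computable n).

Lemma computable_eqn : computable (fun x => m x == n x).
Proof.
apply: (computable_ext (f := fun x => (m x <= n x)%N && (n x <= m x)%N)).
  by move=> x; rewrite eqn_leq.
by computable.
Qed.

Lemma computable_expn : computable (fun x => m x ^ n x)%N.
Proof.
apply: (computable_ext (f := fun x => iter (n x) (muln (m x)) 1)).
  by move=> x; rewrite iter_muln_1.
by computable.
Qed.

(* For [n x = 0] the counter below never wraps, in agreement with
   [m %% 0 = m]. *)
Lemma computable_modn : computable (fun x => m x %% n x)%N.
Proof.
apply: (computable_ext (f := fun x => iter (m x)
    (fun s => if n x <= s.+1 then if n x <= 0 then s.+1 else 0 else s.+1)%N 0)).
  move=> x; elim: (m x) => [|k IH] /=; first by rewrite mod0n.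
  rewrite IH modnS; case: (n x) => [|q]; first by rewrite modn0 dvd0n.
  rewrite ltn0 [k in (_ %| k.+1)%N](divn_eq k q.+1) -addnS.
  rewrite dvdn_addr ?dvdn_mull //.
  have := ltn_pmod k (ltn0Sn q); rewrite leq_eqVlt => /predU1P[->|h].
    by rewrite leqnn dvdnn.
  by rewrite gtnNdvd // leqNgt h.
by computable.
Qed.

End Arithmetic3.

#[global] Hint Extern 1 (computable (fun x => _ == _)) =>
  refine (computable_eqn _ _) : computable.
#[global] Hint Extern 1 (computable (fun x => expn _ _)) =>
  refine (computable_expn _ _) : computable.
#[global] Hint Extern 1 (computable (fun x => modn _ _)) =>
  refine (computable_modn _ _) : computable.

Section Sequences.
Context {A B C : Type} {cA : codable A} {cB : codable B} {cC : codable C}.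
Variable s : A -> seq B.
Hypothesis hs : computable s.

Lemma computable_size : computable (fun x => size (s x)).
Proof.
apply: (computable_ext (f := fun x => foldl (fun k _ => k.+1) 0 (s x))).
  by move=> x; rewrite -[RHS]addn0; elim: (s x) 0 => //= a l IH k;
     rewrite IH addnS.
by computable.
Qed.

Lemma computable_rev : computable (fun x => rev (s x)).
Proof.
apply: (computable_ext (f := fun x => foldl (fun l a => a :: l) [::] (s x))).
  by move=> x; rewrite /rev; elim: (s x) [::] => //=.
by computable.
Qed.

Lemma computable_foldr (f : A -> B -> C -> C) (i : A -> C) :
  computable (fun z : A * B * C => f z.1.1 z.1.2 z.2) -> computable i ->
  computable (fun x => foldr (f x) (i x) (s x)).
Proof.
move=> hf hi.
apply: (computable_ext (f := fun x => foldl (fun c b => f x b c) (i x) (rev (s x)))).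
  by move=> x; rewrite foldl_rev.
apply: computable_foldl => //; last exact: computable_rev.
apply: (computable_comp (g := fun z : A * B * C => f z.1.1 z.1.2 z.2)
         (f := fun z : A * C * B => (z.1.1, z.2, z.1.2))) => //.
by computable.
Qed.
End Sequences.

#[global] Hint Extern 1 (computable (fun x => size _)) =>
  refine (computable_size _) : computable.
#[global] Hint Extern 1 (computable (fun x => rev _)) =>
  refine (computable_rev _) : computable.
#[global] Hint Extern 1 (computable (fun x => foldr _ _ _)) =>
  refine (computable_foldr _ _ _) : computable.

Section Sequences2.
Context {A B C : Type} {cA : codable A} {cB : codable B} {cC : codable C}.
Variables (n m : A -> nat) (s t : A -> seq B).
Hypotheses (hn : computable n) (hm : computable m).
Hypotheses (hs : computable s) (ht : computable t).

Lemma computable_cat : computable (fun x => s x ++ t x).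
Proof.
apply: (computable_ext (f := fun x => foldr cons (t x) (s x))).
  by move=> x; elim: (s x) => //= b l ->.
by computable.
Qed.

Lemma computable_iota : computable (fun x => iota (m x) (n x)).
Proof.
apply: (computable_ext (f := fun x =>
    rev (iter (n x) (fun l => (m x + size l)%N :: l) [::]))).
  move=> x; elim: (n x) => // k IH; rewrite iterS rev_cons IH -cats1.
  by rewrite -size_rev IH size_iota -[k.+1]addn1 iotaD.
by computable.
Qed.

Lemma computable_nth (b : B) : computable (fun x => nth b (s x) (n x)).
Proof.
apply: (computable_ext (f := fun x => head b (iter (n x) behead (s x)))).
  move=> x; elim: (n x) (s x) => [|k IH] [|c l] //=.
  - by rewrite iter_fix.
  - by rewrite -IH -iterS iterSr.
by computable.
Qed.

Lemma computable_map (f : A -> B -> C) :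
  computable (fun z : A * B => f z.1 z.2) ->
  computable (fun x => [seq f x b | b <- s x]).
Proof.
move=> hf.
apply: (computable_ext (f := fun x => foldr (fun b l => f x b :: l) [::] (s x))).
  by move=> x; elim: (s x) => //= b l ->.
apply: computable_foldr => //; last by computable.
apply: computable_cons; last by computable.
apply: (computable_comp (g := fun z : A * B => f z.1 z.2)
         (f := fun z : A * B * seq C => (z.1.1, z.1.2))) => //.
by computable.
Qed.

Variable a : A -> B -> bool.
Hypothesis ha : computable (fun z : A * B => a z.1 z.2).

Let ha' (D : Type) (cD : codable D) : computable (fun z : A * B * D => a z.1.1 z.1.2).
Proof.
apply: (computable_comp (g := fun z : A * B => a z.1 z.2)
         (f := fun z : A * B * D => (z.1.1, z.1.2))) => //.
by computable.
Qed.

Lemma computable_filter : computable (fun x => [seq b <- s x | a x b]).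
Proof.
apply: (computable_ext (f := fun x =>
   foldr (fun b l => if a x b then b :: l else l) [::] (s x))).
  by move=> x; elim: (s x) => //= b l ->.
by apply: computable_foldr => //; [apply: computable_if; [apply: ha'| |] |]; computable.
Qed.

Lemma computable_has : computable (fun x => has (a x) (s x)).
Proof.
apply: (computable_ext (f := fun x => foldr (fun b l => a x b || l) false (s x))).
  by move=> x; elim: (s x) => //= b l ->.
by apply: computable_foldr => //; [apply: computable_orb; [apply: ha'|] |]; computable.
Qed.

Lemma computable_all : computable (fun x => all (a x) (s x)).
Proof.
apply: (computable_ext (f := fun x => foldr (fun b l => a x b && l) true (s x))).
  by move=> x; elim: (s x) => //= b l ->.
by apply: computable_foldr => //; [apply: computable_andb; [apply: ha'|] |]; computable.
Qed.

Lemma computable_nilp : computable (fun x => nilp (s x)).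
Proof. by rewrite /nilp; computable. Qed.

End Sequences2.

#[global] Hint Extern 1 (computable (fun x => _ ++ _)) =>
  refine (computable_cat _ _) : computable.
#[global] Hint Extern 1 (computable (fun x => iota _ _)) =>
  refine (computable_iota _ _) : computable.
#[global] Hint Extern 1 (computable (fun x => nth _ _ _)) =>
  refine (computable_nth _ _ _) : computable.
#[global] Hint Extern 1 (computable (fun x => map _ _)) =>
  refine (computable_map _ _) : computable.
#[global] Hint Extern 1 (computable (fun x => filter _ _)) =>
  refine (computable_filter _ _) : computable.
#[global] Hint Extern 1 (computable (fun x => has _ _)) =>
  refine (computable_has _ _) : computable.
#[global] Hint Extern 1 (computable (fun x => all _ _)) =>
  refine (computable_all _ _) : computable.
#[global] Hint Extern 1 (computable (fun x => nilp _)) =>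
  refine (computable_nilp _) : computable.

Lemma computable_flatten (A B : Type) {cA : codable A} {cB : codable B}
    (s : A -> seq (seq B)) :
  computable s -> computable (fun x => flatten (s x)).
Proof. by move=> hs; rewrite /flatten; computable. Qed.

#[global] Hint Extern 1 (computable (fun x => flatten _)) =>
  refine (computable_flatten _) : computable.

(** * Decoding of trees and unbounded search *)

Fixpoint data_seq (t : data) : seq data :=
  if t is Node a b then a :: data_seq b else [::].

Definition data_pair (t : data) : data * data :=
  if t is Node a b then (a, b) else (Leaf, Leaf).

Section DataClosure.
Context {A : Type} {cA : codable A}.

Lemma computable_Node (f g : A -> data) :
  computable f -> computable g -> computable (fun x => Node (f x) (g x)).
Proof.
move=> [P hP] [Q hQ]; exists (PNode P Q) => x; exact: ENode (hP x) (hQ x).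
Qed.

(** Every tree is literally the code of the list along its right spine, so nothing has to be
    computed. *)
Lemma computable_data_seq (f : A -> data) :
  computable f -> computable (fun x => data_seq (f x)).
Proof.
move=> [P hP]; exists P => x; move: (hP x).
rewrite (_ : code (data_seq (f x)) = code (f x)) //.
by rewrite /code /= /seq_codable; elim: (f x) => //= a _ b ->.
Qed.

Lemma computable_data_pair (f : A -> data) :
  computable f -> computable (fun x => data_pair (f x)).
Proof.
move=> [P hP]; exists (PSeq P (PNode PLeft PRight)) => x.
apply: ESeq (hP x) _; rewrite /code /data_codable.
by case: (f x) => [|a b]; constructor; constructor.
Qed.

End DataClosure.

#[global] Hint Extern 1 (computable (fun x => Node _ _)) =>
  refine (computable_Node _ _) : computable.
#[global] Hint Extern 1 (computable (fun x => data_seq _)) =>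
  refine (computable_data_seq _) : computable.
#[global] Hint Extern 1 (computable (fun x => data_pair _)) =>
  refine (computable_data_pair _) : computable.

(** As [decode] is total and inverts [code], a search through all trees meets every value of the
    type. *)
Class decodable (T : Type) {cT : codable T} := {
  decode : data -> T;
  codeK : forall x, decode (code x) = x;
  computable_decode : computable decode
}.

Arguments decodable T {cT}.

#[global] Hint Extern 1 (computable (fun x => decode _)) =>
  refine (computable_comp computable_decode _) : computable.
#[global] Hint Extern 0 (computable decode) =>
  exact computable_decode : computable.

Lemma code_natK n : size (data_seq (code n)) = n.
Proof. by rewrite /code /= /nat_codable /enc_nat; elim: n => //= n ->. Qed.

Program Instance nat_decodable : decodable nat :=
  {| decode := fun t => size (data_seq t) |}.
Next Obligation. exact: code_natK. Qed.
Next Obligation. by computable. Qed.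

Program Instance bool_decodable : decodable bool :=
  {| decode := fun t => (0 < size (data_seq t))%N |}.
Next Obligation. by case: x. Qed.
Next Obligation. by computable. Qed.

Program Instance prod_decodable (A B : Type) {cA : codable A}
    {cB : codable B} {dA : decodable A} {dB : decodable B} :
    decodable (A * B) :=
  {| decode := fun t => (decode (data_pair t).1, decode (data_pair t).2) |}.
Next Obligation. by rewrite /= !codeK. Qed.
Next Obligation. by computable. Qed.

Program Instance seq_decodable (A : Type) {cA : codable A}
    {dA : decodable A} : decodable (seq A) :=
  {| decode := fun t => map decode (data_seq t) |}.
Next Obligation.
rewrite /code /seq_codable; elim: x => //= a s IH.
by rewrite codeK; congr (_ :: _).
Qed.
Next Obligation.
by apply: (computable_map _ (f := fun _ a => decode a)); computable.
Qed.

Definition trees (n : nat) : seq data :=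
  iter n (fun l => Leaf :: flatten [seq [seq Node a b | b <- l] | a <- l])
    [:: Leaf].

(** The list [trees n] holds the trees of height at most [n]. Predicates stand in for membership,
    since [data] carries no equality test; asking for all larger [n] lets the two subtrees of a node
    share one height. *)
Lemma trees_complete (t : data) :
  exists n0, forall n, n0 <= n -> forall a : pred data, a t -> has a (trees n).
Proof.
elim: t => [|u [m hm] v [k hk]].
  by exists 0 => -[|n] _ a /= ->.
exists (maxn m k).+1 => -[//|n]; rewrite ltnS geq_max => /andP[mn kn] a h.
rewrite /trees iterS -/(trees n) /=; apply/orP; right.
have -> : has a (flatten [seq [seq Node b c | c <- trees n] | b <- trees n])
  = has (fun b => has (fun c => a (Node b c)) (trees n)) (trees n).
  move: (trees n) {2 4}(trees n) => s r; elim: r => //= b r IH.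
  by rewrite has_cat IH has_map.
by apply: (hm n mn (fun b => has (fun c => a (Node b c)) (trees n))); apply: hk.
Qed.

Lemma has_witness (T : Type) (a : pred T) (x0 : T) (s : seq T) :
  has a s -> a (head x0 (filter a s)).
Proof. by elim: s => //= x s IH; case: ifP. Qed.

(** The height bound grows until some tree of that height decodes to a witness. Nothing is claimed
    for inputs without a witness, on which the loop may run forever. The input is kept in the result
    for use by the next program. *)
Lemma computable_search (A B : Type) {cA : codable A} {cB : codable B}
    {dB : decodable B} (a : A -> B -> bool) :
  computable (fun z : A * B => a z.1 z.2) ->
  exists P, forall x, (exists b, a x b) ->
    exists2 b, a x b & eval P (code x) (code (x, b)).
Proof.
move=> ha.
pose g (z : A * nat) (t : data) := a z.1 (@decode B cB dB t).
have hg : computable (fun z : A * nat * data => g z.1 z.2).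
  apply: (computable_comp (g := fun z : A * B => a z.1 z.2)
         (f := fun z : A * nat * data => (z.1.1, @decode B cB dB z.2))) => //.
  by computable.
have ht : computable trees by rewrite /trees; computable.
have [Q hQ] : computable (fun z : A * nat => ~~ has (g z) (trees z.2)).
  by apply: computable_negb; apply: computable_has => //; computable.
have [R hR] : computable (fun z : A * nat => (z.1, z.2.+1)) by computable.
have [S hS] : computable (fun z : A * nat =>
    (z.1, @decode B cB dB (head Leaf [seq t <- trees z.2 | g z t]))).
  apply: computable_pair; first by computable.
  apply: (computable_comp computable_decode); apply: computable_head.
  by apply: computable_filter => //; computable.
exists (PSeq (PNode PId PLeaf) (PSeq (PWhile Q R) S)) => x [b hb].
have : exists n, has (g (x, n)) (trees n).
  have [n hn] := trees_complete (code b); exists n.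
  by apply: (hn n (leqnn n)); rewrite /g codeK.
move=> hex; pose m := ex_minn hex.
have [hm mmin] : has (g (x, m)) (trees m) /\
    forall k, has (g (x, k)) (trees k) -> m <= k.
  by rewrite /m; case: ex_minnP.
exists (@decode B cB dB (head Leaf [seq t <- trees m | g (x, m) t])).
  exact: (has_witness Leaf hm).
apply: ESeq (ENode (EId _) (ELeaf _)) _.
apply: ESeq (hS (x, m)).
(* The induction is on the number of rounds still to go before the least successful height [m]. *)
have loop : forall i, i <= m -> eval (PWhile Q R) (code (x, m - i)) (code (x, m)).
  elim=> [|i IH] im.
    rewrite subn0; apply: EWhileF; have := hQ (x, m); rewrite hm; exact.
  have n0 : has (g (x, m - i.+1)) (trees (m - i.+1)) = false.
    apply/negP => /mmin; rewrite leqNgt -subn_gt0 subKn //.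
  have := hQ (x, m - i.+1); rewrite n0 => h; apply: EWhileT h _ _.
    exact: hR.
  rewrite /= subnSK //; apply: IH; exact: ltnW.
by have := loop m (leqnn m); rewrite subnn; exact: id.
Qed.

(** * The algorithm *)

Notation raw_letter := (nat * bool)%type.
Notation raw_word := (seq raw_letter).
Notation raw_table := (seq (raw_word * (raw_word * (seq (seq nat) * unit)))).

Section Algorithm.
Implicit Types (tbl : seq (seq (nat * nat))) (R ts : seq raw_word)
  (ds : seq (seq (raw_word * raw_letter))) (ws qs : seq (seq nat))
  (mats : seq (seq (seq nat))) (tabs : seq raw_table).

(* Row [i] of [tbl] lists, for each generator, the image of the point [i] under
   the generator and under its inverse. *)
Definition act_letter tbl i (l : raw_letter) : nat :=
  if l.2 then (nth (0, 0) (nth [::] tbl i) l.1).2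
  else (nth (0, 0) (nth [::] tbl i) l.1).1.

Definition act_word tbl i (w : raw_word) : nat := foldl (act_letter tbl) i w.

Definition raw_inv (l : raw_letter) : raw_letter := (l.1, ~~ l.2).

Definition raw_winv (w : raw_word) : raw_word := rev (map raw_inv w).

(** The inner conditional says that the two signs are opposite; it is spelled out by cases because
    the equality test shown computable is the one on numbers. *)
Definition raw_push (l : raw_letter) (w : raw_word) : raw_word :=
  if nilp w then [:: l] else
  if ((head (0, false) w).1 == l.1) &&
     (if l.2 then ~~ (head (0, false) w).2 else (head (0, false) w).2)
  then behead w else l :: w.

Definition free_reduce (w : raw_word) : raw_word := foldr raw_push [::] w.

(* The entry [(g, (k, b))] stands for the conjugate by [g] of the [k]-th relator
   or, if [b] holds, of its inverse. *)
Definition consequence R (D : seq (raw_word * raw_letter)) : raw_word :=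
  flatten [seq raw_winv x.1 ++
    ((if x.2.2 then raw_winv (nth [::] R x.2.1) else nth [::] R x.2.1) ++ x.1)
  | x <- D].

(** The words agree in the presented group once a product of conjugates of relators is freely
    inverse to [u v^-1]. All derivations lie in one pool [ds], so none has to be matched to a table
    entry in advance. *)
Definition derivable R ds (u v : raw_word) : bool :=
  has (fun D => nilp (free_reduce (consequence R D ++ (u ++ raw_winv v)))) ds.

(** Each point [i] is labelled by the word [nth [::] ts i]. The first two tests make the letters act
    as mutually inverse permutations of the points; the third says that labels are multiplied along
    with the points. *)
Definition check_letter R ts tbl ds i (l : raw_letter) : bool :=
  [&& act_letter tbl i l < size ts, act_letter tbl (act_letter tbl i l) (raw_inv l) == i
    & derivable R ds (nth [::] ts i ++ [:: l]) (nth [::] ts (act_letter tbl i l))].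

Definition check_point n R ts tbl ds i : bool :=
  all (fun r => act_word tbl i r == i) R &&
  all (fun j => check_letter R ts tbl ds i (j, false) &&
                check_letter R ts tbl ds i (j, true)) (iota 0 n).

Definition pos_word (w : seq nat) : raw_word := [seq (j, false) | j <- w].

Definition subst ws (q : seq nat) : raw_word :=
  flatten [seq pos_word (nth [::] ws k) | k <- q].

Definition check_gens e n tbl ws qs : bool :=
  [&& all (all (fun j => j < n)) ws, all (all (fun j => j < e)) qs
    & all (fun j => has (fun q =>
        act_word tbl 0 (subst ws q) == act_letter tbl 0 (j, false)) qs) (iota 0 n)].

Definition vadd p d (u v : seq nat) : seq nat :=
  [seq (nth 0 u k + nth 0 v k) %% p | k <- iota 0 d].

Definition vmul p d (u : seq nat) (X : seq (seq nat)) : seq nat :=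
  [seq foldr (fun l s => nth 0 u l * nth 0 (nth [::] X l) k + s) 0 (iota 0 d)
       %% p | k <- iota 0 d].

Definition vact p d mats (u w : seq nat) : seq nat :=
  foldl (fun v j => vmul p d v (nth [::] mats j)) u w.

(** Words of the table are identified by the points they reach from [0]. An element may be spelled
    in several ways, and any matching entry will do. The empty table yields [[::]], the zero vector,
    and so stands for the zero cocycle. *)
Definition lookup tbl (tab : raw_table) (g h : nat) : seq nat :=
  head [::] (head ([::], ([::], ([::], tt)))
    [seq y <- tab | (act_word tbl 0 y.1 == g) &&
                    (act_word tbl 0 y.2.1 == h)]).2.2.1.

Definition unitv d b : seq nat := [seq (if k == b then 1 else 0) | k <- iota 0 d].

(* A coordinate [(tab, (j0, b))] is a row of the extension: the one with the
   cocycle [tab] whose [j0]-th generator has the [b]-th basis vector as its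
   vector part. *)
Definition coordinates e d tabs : seq (raw_table * (nat * nat)) :=
  [seq (t, (e, 0)) | t <- tabs] ++
  flatten [seq [seq ([::], (j, b)) | b <- iota 0 d] | j <- iota 0 e].

(** Right multiplication by the image of [y_j] in the extension, seen in one coordinate only: the
    coordinates interact solely through the [H]-component, here a point of the table. *)
Definition step p d mats tbl ws (c : raw_table * (nat * nat))
    (s : nat * seq nat) (j : nat) : nat * seq nat :=
  (act_word tbl s.1 (pos_word (nth [::] ws j)),
   vadd p d (vadd p d (vact p d mats s.2 (nth [::] ws j))
     (lookup tbl c.1 s.1 (act_word tbl 0 (pos_word (nth [::] ws j)))))
     (if j == c.2.1 then unitv d c.2.2 else [::])).

(** The start [(0, [::])] stands for [(1, 0)], which need not be the identity of the extension. This
    is harmless: a word is trivial if and only if right multiplication by it fixes [(1, 0)]. *)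
Definition run p d mats tbl ws c (w : seq nat) : nat * seq nat :=
  foldl (step p d mats tbl ws c) (0, [::]) w.

Definition is_trivial e p d mats tabs tbl ws (w : seq nat) : bool :=
  all (fun c => ((run p d mats tbl ws c w).1 == 0) &&
                all (fun k => k == 0) (run p d mats tbl ws c w).2)
    (coordinates e d tabs).

Definition words e B : seq (seq nat) :=
  iter B (fun l => [::] :: flatten [seq [seq j :: w | w <- l] | j <- iota 0 e])
    [:: [::]].

(** The order of the extension, with [size ts] for the order of [H]: there are [r + e * d]
    coordinates in a space of dimension [d] over the field with [p] elements. *)
Definition bound e p d tabs ts : nat := size ts * p ^ ((size tabs + e * d) * d).

Definition relators e p d mats tabs ts tbl ws : seq raw_word :=
  [seq pos_word w | w <- [seq w <- words e (bound e p d tabs ts)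
                         | is_trivial e p d mats tabs tbl ws w]].

Definition certificate : Type :=
  seq raw_word * (seq (seq (nat * nat)) *
    (seq (seq (raw_word * raw_letter)) * (seq (seq nat) * seq (seq nat)))).

Definition check e n R (c : certificate) : bool :=
  [&& 0 < size c.1,
      all (check_point n R c.1 c.2.1 c.2.2.1) (iota 0 (size c.1))
    & check_gens e n c.2.1 c.2.2.2.1 c.2.2.2.2].

Definition input : Type :=
  nat * (nat * ((nat * seq raw_word) * (nat * (seq (seq (seq nat)) *
    (seq raw_table * unit))))).

Definition output (z : input * certificate) : nat * seq raw_word :=
  (z.1.1, relators z.1.1 z.1.2.1 z.1.2.2.2.1 z.1.2.2.2.2.1 z.1.2.2.2.2.2.1
     z.2.1 z.2.2.1 z.2.2.2.2.1).

End Algorithm.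

Ltac unfold_algorithm :=
  unfold check, output, relators, is_trivial, run, step, check_gens, check_point,
    check_letter, derivable, consequence, free_reduce, raw_push, raw_winv,
    raw_inv, coordinates, words, bound, lookup, vact, vmul, vadd, unitv, subst,
    pos_word, act_word, act_letter.

Lemma computable_check : computable (fun z : input * certificate =>
  check z.1.1 z.1.2.2.1.1 z.1.2.2.1.2 z.2).
Proof. by unfold_algorithm; computable. Qed.

Lemma computable_output : computable output.
Proof. by unfold_algorithm; computable. Qed.

(** * Words and free groups *)

Import GroupScope GRing.Theory.

Section WordEvaluation.
Variables (n : nat) (G : groupType) (x : 'I_n -> G).
Implicit Types (l : letter n) (u v w : word n).
Local Open Scope group_scope.

Definition leval l : G := if l.2 then (x l.1)^-1 else x l.1.

Lemma weval_nil : weval x [::] = 1.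
Proof. by rewrite /weval big_nil. Qed.

Lemma weval_cons l w : weval x (l :: w) = leval l * weval x w.
Proof. by rewrite /weval big_cons. Qed.

Lemma weval_cat u v : weval x (u ++ v) = weval x u * weval x v.
Proof. by rewrite /weval big_cat. Qed.

Lemma leval_linv l : leval (linv l) = (leval l)^-1.
Proof. by case: l => i [] /=; rewrite /leval /= ?invgK. Qed.

Lemma weval_push l w : weval x (push l w) = leval l * weval x w.
Proof.
case: w => [|l' w] /=; first by rewrite weval_cons.
case: eqP => [->|_]; last by rewrite weval_cons.
by rewrite weval_cons leval_linv mulVKg.
Qed.

Lemma weval_wmul u v : weval x (wmul u v) = weval x u * weval x v.
Proof.
elim: u => [|l u IH]; first by rewrite weval_nil mul1g.
by rewrite /= weval_push IH weval_cons mulgA.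
Qed.

Lemma weval_winv w : weval x (winv w) = (weval x w)^-1.
Proof.
rewrite /winv; elim: w => [|l w IH]; first by rewrite weval_nil invg1.
rewrite map_cons rev_cons -cats1 weval_cat IH !weval_cons weval_nil mulg1.
by rewrite leval_linv invgM.
Qed.

Lemma wevalM (f g : free_group n) : weval x (f * g) = weval x f * weval x g.
Proof. exact: weval_wmul. Qed.

Lemma wevalV (f : free_group n) : weval x f^-1 = (weval x f)^-1.
Proof. exact: weval_winv. Qed.

Lemma weval_fgen i : weval x (fgen i) = x i.
Proof. by rewrite /weval big_cons big_nil /= mulg1. Qed.

End WordEvaluation.

Section FreeGroupHom.
Variable n : nat.
Local Open Scope group_scope.

Lemma weval_free (w : word n) : fword (weval (@fgen n) w) = wmul w [::].
Proof.
elim: w => [|l w IH]; first by rewrite weval_nil.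
rewrite weval_cons /= -IH; case: l => i [] //=.
Qed.

Lemma weval_fgenK (f : free_group n) : weval (@fgen n) f = f.
Proof. by apply/val_inj; rewrite /= weval_free wmulw0 //; apply: valP. Qed.

Lemma weval_weval (G : groupType) (x : 'I_n -> G) (w : word n) :
  weval x (weval (@fgen n) w) = weval x w.
Proof. by rewrite weval_free weval_wmul weval_nil mulg1. Qed.

Variables (G : groupType) (psi : free_group n -> G).
Hypothesis psiM : {morph psi : f g / f * g}.

Lemma hom1 : psi 1 = 1.
Proof. by apply: (mulgI (psi 1)); rewrite -psiM !mulg1. Qed.

Lemma homV f : psi f^-1 = (psi f)^-1.
Proof. by apply: (mulgI (psi f)); rewrite -psiM !mulgV hom1. Qed.

Lemma homJ f g : psi (f ^ g) = psi f ^ psi g.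
Proof. by rewrite /conjg !psiM homV. Qed.

Lemma hom_wevalE (m : nat) (y : 'I_m -> free_group n) (w : word m) :
  psi (weval y w) = weval (psi \o y) w.
Proof.
elim: w => [|l w IH]; first by rewrite !weval_nil hom1.
by rewrite !weval_cons psiM IH /leval; case: l.2; rewrite ?homV.
Qed.

Lemma hom_weval f : psi f = weval (psi \o @fgen n) f.
Proof. by rewrite -hom_wevalE weval_fgenK. Qed.

End FreeGroupHom.

Section NormalClosure.
Variables (H : groupType) (A : set H).
Local Open Scope group_scope.

Lemma normal_closureM x y :
  normal_closure A x -> normal_closure A y -> normal_closure A (x * y).
Proof.
have [[h1 hF] _] := normal_closureP A => hx hy.
by rewrite -[y]invgK -[y^-1]mul1g; apply: (hF) => //; apply: hF.
Qed.

Lemma normal_closureV x :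
  normal_closure A x -> normal_closure A x^-1.
Proof.
have [[h1 hF] _] := normal_closureP A => hx.
by rewrite -[x^-1]mul1g; apply: hF.
Qed.

Lemma normal_closure1 : normal_closure A 1.
Proof. by have [[h1 _] _] := normal_closureP A. Qed.

Lemma normal_closureJ x y :
  normal_closure A x -> normal_closure A (x ^ y).
Proof. by have [_] := normal_closureP A; apply. Qed.

End NormalClosure.

(* Removing a nonempty segment with trivial value, which exists by the
   pigeonhole principle once the word is longer than the order of the group,
   reduces every trivial positive word to the short ones. *)
Section ShortRelators.
Variables (e : nat) (G : finGroupType) (z : 'I_e -> G) (B : nat).
Hypothesis cardB : #|G| <= B.
Variable R : set (word e).
Local Open Scope group_scope.

Definition positive (w : seq 'I_e) : word e := [seq (j, false) | j <- w].

Hypothesis shortR : forall w, size w <= B -> weval z (positive w) = 1 ->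
  R (positive w).
Hypothesis trivR : forall w, R w -> weval z w = 1.

Let N := normal_closure [set weval (@fgen e) r | r in R].

Lemma positive_trivial w : weval z (positive w) = 1 ->
  N (weval (@fgen e) (positive w)).
Proof.
have [m] := ubnP (size w); elim: m w => // m IH w; rewrite ltnS => wm hw.
have [wB|Bw] := leqP (size w) B.
  by move=> A [hA sub]; apply: sub; exists (positive w) => //; apply: shortR.
(* The [B.+1] prefixes of length at most [B] have at most [B] values, so two coincide. The segment
   [b] between them is trivial and, having length at most [B], shorter than [w]. *)
pose f (i : 'I_B.+1) := weval z (positive (take i w)).
have /injectivePn[i [j ij fij]] : ~~ injectiveb f.
  apply/negP => /injectiveP/leq_card; rewrite card_ord leqNgt ltnS.
  by rewrite cardB.
wlog lt_ij : i j ij fij / i < j => [hwlog|].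
  have [|h|/val_inj e0] := ltngtP i j; first exact: hwlog.
    by apply: (hwlog j i) => //; rewrite eq_sym.
  by rewrite e0 eqxx in ij.
pose a := take i w; pose b := take (j - i) (drop i w); pose c := drop j w.
have ab : take j w = a ++ b by rewrite -{1}(subnKC (ltnW lt_ij)) takeD.
have wE : w = a ++ b ++ c by rewrite catA -ab cat_take_drop.
have sb : size b = j - i.
  rewrite size_take size_drop ltn_sub2rE; last exact: ltnW.
  case: ltnP => // h; have := leq_trans h (ltn_ord j).
  by move=> h2; have := leq_trans Bw h; rewrite ltnNge -ltnS ltn_ord.
have hb : weval z (positive b) = 1.
  apply: (mulgI (weval z (positive a))).
  by rewrite mulg1 -weval_cat -map_cat -ab -/(positive _) -/(f j) -fij.
have jB : j <= B by rewrite -ltnS.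
have Nb : N (weval (@fgen e) (positive b)).
  apply: IH => //; apply: leq_trans wm; rewrite sb.
  by apply: leq_ltn_trans (leq_subr _ _) _; apply: leq_ltn_trans Bw.
have Nac : N (weval (@fgen e) (positive (a ++ c))).
  apply: IH.
    apply: leq_trans wm; rewrite [in X in _ < X]wE !size_cat ltn_add2l.
    by rewrite -[X in X < _]add0n ltn_add2r sb subn_gt0.
  move: hw; rewrite wE /positive !map_cat !weval_cat -!/(positive _) hb.
  by rewrite mul1g.
move: Nac; rewrite wE /positive !map_cat !weval_cat -!/(positive _).
set fa := weval _ _; set fc := weval _ _; set fb := weval _ _ in Nb * => Nac.
rewrite (_ : fa * (fb * fc) = (fb ^ fa^-1) * (fa * fc)).
  by apply: normal_closureM => //; apply: normal_closureJ.
by rewrite /conjg invgK !mulgA mulgVK.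
Qed.

(** Modulo the relators an inverse generator is a positive power: the power of a generator to its
    order in [G] is a trivial positive word, to which [positive_trivial] applies. *)
Lemma positive_repr (w : word e) :
  exists u, N (weval (@fgen e) w * (weval (@fgen e) (positive u))^-1).
Proof.
elim: w => [|[i b] w [u hu]].
  by exists [::]; rewrite weval_nil invg1 mulg1; apply: normal_closure1.
pose m := #[z i].-1.
pose s := if b then nseq m i else [:: i].
exists (s ++ u).
rewrite /positive map_cat !weval_cat -!/(positive _) weval_cons.
set fl := leval _ _; set fw := weval _ w; set fu := weval _ (positive u) in hu *.
set fs := weval _ (positive s).
have hs : N (fl * fs^-1).
  rewrite /fl /fs /leval /s /=; case: b {fl fs s} => /=; last first.
    rewrite weval_cons weval_nil mulg1 /leval /= mulgV; exact: normal_closure1.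
  rewrite -invgM; apply: normal_closureV.
  rewrite -[_ * _]mulg1 -(weval_nil (@fgen e)) -mulgA.
  have -> : weval (@fgen e) (positive (nseq m i)) * (fgen i * weval (@fgen e) [::]) =
            weval (@fgen e) (positive (nseq m i ++ [:: i])).
    by rewrite /positive map_cat weval_cat weval_cons.
  apply: positive_trivial; rewrite /positive map_cat map_nseq weval_cat.
  rewrite weval_cons weval_nil mulg1 /leval /=.
  have -> : weval z (nseq m (i, false)) = z i ^+ m.
    elim: m => [|k IH]; first by rewrite weval_nil.
    by rewrite /= weval_cons IH expgS.
  by rewrite -expgSr prednK ?order_gt0 ?expg_order.
rewrite (_ : fl * fw * _ = (fw * fu^-1) ^ fl^-1 * (fl * fs^-1)).
  by apply: normal_closureM => //; apply: normal_closureJ.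
by rewrite /conjg !invgM invgK !mulgA mulgVK.
Qed.

Lemma short_relators (f : free_group e) : weval z f = 1 <-> N f.
Proof.
have NE g : N g -> weval z g = 1.
  move=> h; pose K : set (free_group e) := fun f => weval z f = 1.
  change (K g); apply: (h K); split.
    split; first split.
    - exact: weval_nil.
    - by move=> x y hx hy; rewrite /K wevalM wevalV hx hy mulgV.
    - by move=> x y hx; rewrite /K /conjg !wevalM wevalV hx mul1g mulVg.
  by move=> _ [r Rr <-]; rewrite /K weval_weval; apply: trivR.
split => [hf|]; last exact: NE.
have [u hu] := positive_repr (fword f); rewrite weval_fgenK in hu.
have := NE _ hu; rewrite wevalM wevalV hf mul1g weval_weval => /eqP.
rewrite invg_eq1 => /eqP/positive_trivial/(normal_closureM hu).
by rewrite mulgVK.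
Qed.

End ShortRelators.

(** * Gaschutz's lemma *)

Section Gaschutz.
Variables (G H : finGroupType) (f : G -> H) (e : nat).
Hypothesis fM : {morph f : x y / x * y}.
Implicit Types (K L : {group G}) (h : 'I_e -> H) (t : {ffun 'I_e -> G}).

Definition tuple_gen (T : finGroupType) (t : 'I_e -> T) : {set T} :=
  <<[set t i | i : 'I_e]%SET>>.

Definition lifts K h : {set {ffun 'I_e -> G}} :=
  [set t : {ffun 'I_e -> G} | [forall i, (t i \in K) && (f (t i) == h i)]]%SET.

Definition generating_lifts K h : {set {ffun 'I_e -> G}} :=
  [set t in lifts K h | tuple_gen t == K :> {set G}]%SET.

Let onto K := [forall y, exists x in K, f x == y].

(** Componentwise translation by elements of [K] lying over [(h i)^-1 * h' i] carries lifts of [h]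
    injectively to lifts of [h']. *)
Lemma leq_card_lifts K h h' : onto K -> #|lifts K h| <= #|lifts K h'|.
Proof.
move=> /forallP oK.
have /fin_all_exists[c hc] i : exists c, c \in K /\ f c = (h i)^-1 * h' i.
  by have /existsP[c /andP[cK /eqP fc]] := oK ((h i)^-1 * h' i); exists c.
pose g t : {ffun 'I_e -> G} := [ffun i => t i * c i].
have gI : injective g.
  move=> t t' /ffunP gt; apply/ffunP => i; have := gt i; rewrite !ffunE.
  exact: mulIg.
rewrite -(card_imset _ gI); apply/subset_leq_card/fintype.subsetP => _ /imsetP[t ht ->].
move: ht; rewrite !inE => /forallP ht; apply/forallP => i.
have [ci fc] := hc i; have /andP[tK /eqP ft] := ht i.
by rewrite ffunE groupM //= fM ft fc mulKVg.
Qed.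

Lemma tuple_gen_onto h t K :
  tuple_gen h = [set: H] -> (forall i, f (t i) = h i) -> tuple_gen t = K ->
  onto K.
Proof.
move=> hh ft tK; apply/forallP => y.
pose S := [set f x | x in K]%SET.
have gS : group_set S.
  apply/group_setP; split.
    apply/imsetP; exists 1 => //; apply: (mulgI (f 1)).
    by rewrite -fM !mulg1.
  move=> _ _ /imsetP[a aK ->] /imsetP[b bK ->]; rewrite -fM.
  by apply: imset_f; rewrite groupM.
have : y \in S.
  have : y \in [set: H]%SET by rewrite inE.
  rewrite -hh; apply/fintype.subsetP; rewrite (gen_subG _ (Group gS)).
  apply/fintype.subsetP => _ /imsetP[i _ ->]; rewrite -ft; apply: imset_f.
  by rewrite -tK; apply: mem_gen; apply: imset_f.
by case/imsetP => x xK ->; apply/existsP; exists x; rewrite xK eqxx.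
Qed.

(** Lifts are sorted by the subgroup they generate, which maps onto [H] because [h] generates
    [H]. *)
Lemma card_lifts K h : tuple_gen h = [set: H] ->
  #|lifts K h| = \sum_(L : {group G} | (L \subset K) && onto L)
                   #|generating_lifts L h|.
Proof.
move=> hh; rewrite -sum1_card.
rewrite (partition_big (fun t => <<[set t i | i : 'I_e]%SET>>%G)
  (fun L => (L \subset K) && onto L)) /=; last first.
  move=> t; rewrite inE => /forallP ht; apply/andP; split.
    rewrite gen_subG; apply/fintype.subsetP => _ /imsetP[i _ ->].
    by have /andP[] := ht i.
  apply: (tuple_gen_onto hh) => // i; by have /andP[_ /eqP] := ht i.
apply: eq_bigr => L /andP[LK _]; rewrite -sum1_card; apply: eq_bigl => t.
rewrite !inE -val_eqE /=; apply/andP/andP => -[/forallP ht /eqP gt].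
  split; last exact/eqP.
  apply/forallP => i; have /andP[_ ->] := ht i; rewrite andbT -[L : {set _}]gt.
  by apply: mem_gen; apply: imset_f.
split; last exact/eqP.
by apply/forallP => i; have /andP[/(fintype.subsetP LK)-> ->] := ht i.
Qed.

(** The totals in [card_lifts] agree for [h] and [h'], and by induction so do the terms of the
    proper subgroups; the term of [K] itself is what remains. *)
Lemma card_generating_lifts K h h' :
  tuple_gen h = [set: H] -> tuple_gen h' = [set: H] -> onto K ->
  #|generating_lifts K h| = #|generating_lifts K h'|.
Proof.
move=> hh hh'; have [m] := ubnP #|K|; elim: m K => // m IH K; rewrite ltnS => Km oK.
have : #|lifts K h| = #|lifts K h'|.
  by apply/eqP; rewrite eqn_leq !leq_card_lifts.
rewrite !card_lifts // (bigD1 K) ?subxx //= [in RHS](bigD1 K) ?subxx //=.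
rewrite (eq_bigr (fun L : {group G} => #|generating_lifts L h'|)); last first.
  move=> L /andP[/andP[LK oL] nLK]; apply: IH => //.
  apply: leq_trans Km; apply: proper_card; rewrite finset.properEneq LK andbT.
  by apply: contraNneq nLK => e0; apply/eqP/val_inj.
by move/addIn.
Qed.

(** The number of lifts generating the same subgroup as [t] does not depend on the generating tuple
    lifted, and it is positive for the image of [t], which [t] lifts. *)
Theorem gaschutz h' t :
  tuple_gen (fun i => f (t i)) = [set: H] -> tuple_gen h' = [set: H] ->
  exists t', (forall i, f (t' i) = h' i) /\ tuple_gen t' = tuple_gen t.
Proof.
move=> ht hh'; pose K := <<[set t i | i : 'I_e]%SET>>%G.
have oK : onto K by apply: (tuple_gen_onto ht).
have : 0 < #|generating_lifts K (fun i => f (t i))|.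
  apply/card_gt0P; exists t; rewrite !inE eqxx andbT; apply/forallP => i.
  by rewrite eqxx andbT; apply: mem_gen; apply: imset_f.
rewrite (card_generating_lifts ht hh' oK) => /card_gt0P[t'].
rewrite !inE => /andP[/forallP h1 /eqP h2]; exists t'; split=> // i.
by have /andP[_ /eqP] := h1 i.
Qed.

End Gaschutz.

(** * Extensions and derivations *)

Lemma free_group_ind n (P : free_group n -> Prop) :
  P 1 -> (forall i, P (fgen i)) -> (forall f g, P f -> P g -> P (f * g)) ->
  (forall f, P f -> P f^-1) -> forall f, P f.
Proof.
move=> P1 Pgen PM PV f; rewrite -(weval_fgenK f).
elim: (fword f) => [|[i b] w IH]; first by rewrite weval_nil.
by rewrite weval_cons; apply: PM => //; rewrite /leval; case: b => /=; auto.
Qed.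

Ltac gen_rows := repeat match goal with
  |- context [@mulmx ?R ?m ?n ?q ?A ?B] =>
     let X := fresh "X" in set X := (@mulmx R m n q A B); clearbody X end.

(** Entrywise [ring], with matrix products made opaque. An equation on top of the goal is used once,
    with coefficient 1 or -1. *)
Ltac row_ring := gen_rows;
  first [ let h := fresh in let k := fresh in move/rowP => h; apply/rowP => k;
     move: (h k); rewrite !mxE => {}h; lazymatch type of h with ?A = ?B =>
     apply: subr0_eq; first
       [ transitivity (A - B)%R; [ring | by apply/eqP; rewrite subr_eq0; apply/eqP]
       | transitivity (B - A)%R;
           [ring | by apply/eqP; rewrite subr_eq0; apply/eqP/esym] ]
     end
   | let k := fresh in apply/rowP => k; rewrite !mxE; ring].

Section Extension.
Variables (p d : nat) (gT : finGroupType).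
Variable rV : mx_representation 'F_p [set: gT]%G d.
Variable I : finType.
Local Open Scope ring_scope.

Lemma repr_mxMT g h : rV (g * h)%g = rV g *m rV h.
Proof. by rewrite repr_mxM ?inE. Qed.

Lemma repr_mx1T : rV 1%g = 1%:M.
Proof. exact: repr_mx1. Qed.

Record cocycle_family := CocycleFamily {
  cocycle_fun :> I -> cochain2 p d gT;
  cocycle_funP : forall i, cocycle2 rV (cocycle_fun i)
}.

Lemma cocycle2_1r (c : cochain2 p d gT) g : cocycle2 rV c ->
  c (g, 1%g) = c (1%g, 1%g).
Proof.
move=> hc; have := hc g 1%g 1%g; rewrite !mulg1 repr_mx1T mulmx1.
exact: addrI.
Qed.

Lemma cocycle2_1l (c : cochain2 p d gT) g : cocycle2 rV c ->
  c (1%g, g) = c (1%g, 1%g) *m rV g.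
Proof.
move=> hc; have := hc 1%g 1%g g; rewrite !mul1g addrC => /addIr; exact: esym.
Qed.

(** The fibre product over [gT] of the extensions of [gT] by [V] with cocycles [c i]. *)
Definition extension (c : cocycle_family) : Type :=
  (gT * {ffun I -> 'rV['F_p]_d})%type.

Variable c : cocycle_family.
HB.instance Definition _ := Finite.copy (extension c)
  (gT * {ffun I -> 'rV['F_p]_d})%type.

Definition ext_mul (x y : extension c) : extension c :=
  ((x.1 * y.1)%g, [ffun i => x.2 i *m rV y.1 + y.2 i + c i (x.1, y.1)]).
Definition ext_one : extension c := (1%g, [ffun i => - c i (1%g, 1%g)]).
Definition ext_inv (x : extension c) : extension c :=
  (x.1^-1%g, [ffun i => - (x.2 i *m rV x.1^-1%g) - c i (x.1, x.1^-1%g)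
                        - c i (1%g, 1%g)]).

Lemma ext_mulA : associative ext_mul.
Proof.
move=> x y z; congr pair; rewrite /= ?mulgA //; apply/ffunP => i.
rewrite !ffunE /= !mulmxDl -mulmxA -repr_mxMT.
move: (cocycle_funP c i x.1 y.1 z.1); row_ring.
Qed.

Lemma ext_mul1g : left_id ext_one ext_mul.
Proof.
move=> [g a]; congr pair; rewrite /= ?mul1g //; apply/ffunP => i.
rewrite !ffunE /= mulNmx -(cocycle2_1l g (cocycle_funP c i)).
by rewrite addrC addrA subrr add0r.
Qed.

Lemma ext_mulVg : left_inverse ext_one ext_inv ext_mul.
Proof.
move=> [g a]; congr pair; rewrite /= ?mulVg //; apply/ffunP => i.
rewrite !ffunE /= !mulmxDl !mulNmx -mulmxA -repr_mxMT mulVg repr_mx1T mulmx1.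
rewrite -(cocycle2_1l g (cocycle_funP c i)).
have := cocycle_funP c i g g^-1%g g; rewrite mulgV mulVg.
rewrite (cocycle2_1r g (cocycle_funP c i)) (cocycle2_1l g (cocycle_funP c i)).
row_ring.
Qed.

HB.instance Definition _ :=
  Finite_isGroup.Build (extension c) ext_mulA ext_mul1g ext_mulVg.

End Extension.

Section Derivations.
Variables (p d e : nat) (gT : finGroupType).
Variable rV : mx_representation 'F_p [set: gT]%G d.
Local Notation F := (free_group e).
Local Notation V := 'rV['F_p]_d.
Local Open Scope ring_scope.

(** The condition says that [f] going to [(psi f, tau f)] respects the product twisted by [c]; when
    [c] is a cocycle this is a homomorphism to the extension. *)
Definition derivation (psi : F -> gT) (c : gT * gT -> V) (tau : F -> V) :=
  forall f g, tau (f * g)%g = tau f *m rV (psi g) + tau g + c (psi f, psi g).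

(** An [H]-homomorphism from [ker psi] to [V], kept as a function on [F] whose values off the kernel
    are arbitrary. *)
Definition equivariant (psi : F -> gT) (phi : F -> V) :=
  (forall a b, psi a = 1%g -> psi b = 1%g -> phi (a * b)%g = phi a + phi b) /\
  (forall a f, psi a = 1%g -> phi (a ^ f)%g = phi a *m rV (psi f)).

Definition equivariant_kernel (psi : F -> gT) (f : F) :=
  psi f = 1%g /\ forall phi, equivariant psi phi -> phi f = 0.

Section FixedHom.
Variable psi : F -> gT.
Hypothesis psiM : {morph psi : f g / (f * g)%g}.

Let psi1 := hom1 psiM.
Let psiV := homV psiM.

Lemma equivariant1 phi : equivariant psi phi -> phi 1%g = 0.
Proof.
by case=> h _; apply: (addrI (phi 1%g)); rewrite -h // mulg1 addr0.
Qed.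

Lemma equivariantV phi a : equivariant psi phi -> psi a = 1%g ->
  phi a^-1%g = - phi a.
Proof.
move=> hphi ha; apply: (addrI (phi a)); rewrite subrr -hphi.1 //.
  by rewrite mulgV equivariant1.
by rewrite psiV ha invg1.
Qed.

(** On the kernel the twisting terms reduce to [tau 1], which the subtraction removes. Compatibility
    with the action comes from expanding [tau] at [a * f], which is also [f * a ^ f]. *)
Lemma derivation_equivariant c tau : derivation psi c tau ->
  equivariant psi (fun f => tau f - tau 1%g).
Proof.
move=> h; have h1 := h 1%g 1%g.
rewrite mulg1 psi1 repr_mx1T mulmx1 in h1.
split=> [a b ha hb|a f ha].
  by rewrite h ha hb repr_mx1T mulmx1; move: h1; row_ring.
have c1 : c (1%g, psi f) = - (tau 1%g *m rV (psi f)).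
  by have := h 1%g f; rewrite mul1g psi1; row_ring.
have c2 : c (psi f, 1%g) = - tau 1%g.
  by have := h f 1%g; rewrite mulg1 psi1 repr_mx1T mulmx1; row_ring.
have := h f (a ^ f)%g; rewrite /conjg mulKVg -/(conjg a f) h.
by rewrite (homJ psiM) ha conj1g repr_mx1T mulmx1 c1 c2 mulmxBl; row_ring.
Qed.

(** The cocycle forces the value at [1]; values at inverses follow from [f^-1 * f = 1], since
    [psi f] acts invertibly. *)
Lemma derivation_unique c tau tau' :
  derivation psi c tau -> derivation psi c tau' ->
  (forall j, tau (fgen j) = tau' (fgen j)) -> tau =1 tau'.
Proof.
move=> h h' hgen.
have e1 : tau 1%g = tau' 1%g.
  have := h 1%g 1%g; have := h' 1%g 1%g.
  rewrite mulg1 psi1 repr_mx1T !mulmx1 => k' k.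
  have {}k : c (1%g, 1%g) = - tau 1%g by move: k; row_ring.
  by move: k'; rewrite k; row_ring.
apply: free_group_ind => // [f g hf hg|f hf]; first by rewrite h h' hf hg.
have := h f^-1%g f; have := h' f^-1%g f; rewrite mulVg -e1 hf => -> /eqP.
rewrite !(inj_eq (addIr _)) => /eqP/(congr1 (mulmx^~ (rV (psi f^-1%g)))).
by rewrite -!mulmxA -repr_mxMT -psiM mulgV psi1 repr_mx1T !mulmx1.
Qed.

Lemma derivation_sum (J : finType) (a : J -> 'F_p) (c : J -> gT * gT -> V)
    (tau : J -> F -> V) :
  (forall j, derivation psi (c j) (tau j)) ->
  derivation psi (fun g => \sum_j a j *: c j g) (fun f => \sum_j a j *: tau j f).
Proof.
move=> h f g; rewrite mulmx_suml -!big_split /=; apply: eq_bigr => j _.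
by rewrite h !scalerDr scalemxAl.
Qed.

Hypothesis psi_surj : forall h, exists f, psi f = h.

(** The cocycle identity is associativity in [F], transported by [psi]; this spares a direct
    computation with sections. *)
Lemma derivation_cocycle c tau :
  derivation psi c tau -> forall g h k,
  c ((g * h)%g, k) + c (g, h) *m rV k = c (g, (h * k)%g) + c (h, k).
Proof.
move=> hd g h k; have [f1 <-] := psi_surj g; have [f2 <-] := psi_surj h.
have [f3 <-] := psi_surj k; rewrite -!psiM.
have hc f f' : c (psi f, psi f') = tau (f * f')%g - tau f *m rV (psi f') - tau f'.
  by rewrite hd; row_ring.
rewrite !hc psiM repr_mxMT mulgA !mulmxBl mulmxA; row_ring.
Qed.

(* With a section [s] of [psi], [tau f] is [phi ((s (psi f))^-1 * f)]. *)
Lemma equivariant_derivation phi : equivariant psi phi ->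
  exists (c : cochain2 p d gT) (tau : F -> V),
    [/\ cocycle2 rV c, derivation psi c tau &
        forall a, psi a = 1%g -> tau a = phi a].
Proof.
move=> hphi; have [s0 hs0] := choice psi_surj.
(* Normalized at [1], so that [tau] agrees with [phi] on the kernel. *)
pose s h : F := if h == 1%g then 1%g else s0 h.
have s1 : s 1%g = 1%g by rewrite /s eqxx.
have hs h : psi (s h) = h by rewrite /s; case: eqP => [->|].
pose tau f := phi ((s (psi f))^-1 * f)%g.
pose c : cochain2 p d gT := [ffun x => phi ((s (x.1 * x.2))^-1 * (s x.1 * s x.2))%g].
have hd : derivation psi c tau.
  move=> f g; rewrite /tau ffunE /=.
  pose m := ((s (psi f))^-1 * f)%g; pose m' := ((s (psi g))^-1 * g)%g.
  have hm : psi m = 1%g by rewrite psiM psiV hs mulVg.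
  have hm' : psi m' = 1%g by rewrite psiM psiV hs mulVg.
  (* The three factors are the argument of [phi] in [c], the kernel part of [f] moved past the
     section, and the kernel part of [g]. *)
  rewrite (_ : _ * (f * g) = ((s (psi f * psi g))^-1 * (s (psi f) * s (psi g))) *
     (m ^ s (psi g) * m'))%g; last first.
    by rewrite psiM /conjg !mulgA !mulgK.
  have hmJ : psi (m ^ s (psi g))%g = 1%g by rewrite (homJ psiM) hm conj1g.
  rewrite hphi.1; first last.
  - by rewrite psiM hmJ hm' mulg1.
  - by rewrite !psiM psiV !hs mulVg.
  by rewrite [phi (m ^ _ * _)%g]hphi.1 // hphi.2 // hs addrC.
exists c, tau; split=> //; last first.
  by move=> a ha; rewrite /tau ha s1 invg1 mul1g.
exact: derivation_cocycle hd.
Qed.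

End FixedHom.
End Derivations.

Lemma tuple_genP e (G : finGroupType) (z : 'I_e -> G) g :
  g \in tuple_gen z <-> exists f : free_group e, weval z f = g.
Proof.
split=> [|[f <-]]; last first.
  elim/free_group_ind: f => [|i|f g' hf hg|f hf].
  - by rewrite [weval _ _]weval_nil group1.
  - by rewrite weval_fgen mem_gen //; apply: imset_f.
  - by rewrite wevalM groupM.
  - by rewrite wevalV groupV.
pose S := [set g | `[< exists f : free_group e, weval z f = g >]]%SET.
have gS : group_set S.
  apply/group_setP; split; first by rewrite inE; apply/asboolP; exists 1; rewrite [LHS]weval_nil.
  move=> a b; rewrite !inE => -[f <-] [f' <-].
  by exists (f * f'); rewrite wevalM.
suff /fintype.subsetP/(_ g) sub : tuple_gen z \subset S by move/sub; rewrite inE => /asboolP.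
rewrite (gen_subG _ (Group gS)); apply/fintype.subsetP => _ /imsetP[i _ ->].
by rewrite inE; apply/asboolP; exists (fgen i); rewrite weval_fgen.
Qed.

Lemma tuple_gen_surj e (G : finGroupType) (psi : free_group e -> G) :
  {morph psi : f g / f * g} -> (forall h, exists f, psi f = h) ->
  tuple_gen (psi \o @fgen e) = [set: G]%SET.
Proof.
move=> psiM surj; apply/setP => h; rewrite inE; apply/tuple_genP.
by have [f <-] := surj h; exists f; rewrite -hom_weval.
Qed.

(** * The finite extension that realizes the cover *)

Section CoverExtension.
Variables (p d e r : nat) (gT : finGroupType).
Variable rV : mx_representation 'F_p [set: gT]%G d.
Variable cs : 'I_r -> cochain2 p d gT.
Hypothesis cs_basis : H2_basis rV cs.
Local Notation F := (free_group e).
Local Notation V := 'rV['F_p]_d.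
Local Notation I := ('I_r + 'I_e * 'I_d)%type.
Local Open Scope ring_scope.

Definition cover_cochain (i : I) : cochain2 p d gT :=
  if i is inl j then cs j else 0.

Lemma cover_cochainP i : cocycle2 rV (cover_cochain i).
Proof.
case: i => [j|jb]; first by case: cs_basis => /(_ j).
by move=> g h k; rewrite !ffunE mul0mx.
Qed.

Definition cover_family : cocycle_family rV I := CocycleFamily cover_cochainP.

Local Notation E := (extension cover_family).

Lemma ext_fstM : {morph (fun x : E => x.1) : x y / (x * y)%g}.
Proof. by []. Qed.

(** Coordinate [(j', b)] carries the derivation equal to the [b]-th basis vector at the [j']-th
    generator and to [0] at the others. The cocycle coordinates vanish at every generator. *)
Definition cover_gen (h : 'I_e -> gT) (j : 'I_e) : E :=
  (h j, [ffun i => if i is inr (j', b) then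
                     if j == j' then delta_mx 0 b else 0 else 0]).

Lemma ext_derivation (z : 'I_e -> E) psi : {morph psi : f g / (f * g)%g} ->
  (forall j, psi (fgen j) = (z j).1) ->
  (forall f : F, (weval z f).1 = psi f) /\
  forall i, derivation rV psi (cover_family i) (fun f => (weval z f).2 i).
Proof.
move=> psiM hz.
have h1 (f : F) : (weval z f).1 = psi f.
  rewrite (hom_weval psiM f); elim: (fword f) => [|l w IH]; first by rewrite !weval_nil.
  rewrite !weval_cons -IH /=; congr (_ * _)%g; rewrite /leval.
  by case: l.2; rewrite /= hz.
split=> // i f g; rewrite wevalM /= ffunE; congr (_ + _).
  by rewrite h1.
by rewrite !h1.
Qed.

Section Kernel.
Variable psi : F -> gT.
Hypothesis psiM : {morph psi : f g / (f * g)%g}.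
Hypothesis psi_surj : forall h, exists f, psi f = h.

(** Every coordinate of a lift is a derivation, hence a homomorphism on the kernel up to a constant.
    The lift [z] is arbitrary because the tuple from Gaschutz's lemma need not be a [cover_gen]. *)
Lemma equivariant_kernel_weval (z : 'I_e -> E) f :
  (forall j, psi (fgen j) = (z j).1) ->
  equivariant_kernel rV psi f -> weval z f = 1%g.
Proof.
move=> hz [psif hf]; have [h1 h2] := ext_derivation psiM hz.
rewrite -(weval_nil z) -[[::]]/(fword (1%g : F)).
rewrite [LHS]surjective_pairing [RHS]surjective_pairing; congr pair.
  by rewrite !h1 psif (hom1 psiM).
apply/ffunP => i; apply/eqP; rewrite -subr_eq0.
by rewrite (hf _ (derivation_equivariant psiM (h2 i))).
Qed.

Definition cover_map : F -> E := fun f => weval (cover_gen (psi \o @fgen e)) f.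

Lemma cover_mapM : {morph cover_map : f g / (f * g)%g}.
Proof. by move=> f g; apply: wevalM. Qed.

Lemma cover_map1 (f : F) : (cover_map f).1 = psi f.
Proof.
by have [-> _] := @ext_derivation (cover_gen (psi \o @fgen e)) psi psiM (fun=> erefl).
Qed.

Lemma cover_mapP f : cover_map f = 1%g <-> equivariant_kernel rV psi f.
Proof.
split=> [hf|]; last exact: equivariant_kernel_weval.
split=> [|phi hphi]; first by rewrite -cover_map1 hf.
have [_ hD] := @ext_derivation (cover_gen (psi \o @fgen e)) psi psiM (fun=> erefl).
have [c [tau [hc hd htau]]] := equivariant_derivation psiM psi_surj hphi.
have [_ _ /(_ c hc)[a [t ht]]] := cs_basis.
pose c' g : V := \sum_i a i *: cs i g.
(* Adding [t] after [psi] absorbs the coboundary, so [tau'] is a derivation for the combination [c']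
   itself. *)
pose tau' f : V := tau f + t (psi f).
have hc' g h : c (g, h) = c' (g, h) + (t g *m rV h + t h - t (g * h)%g).
  have -> : c' (g, h) = \sum_i (a i *: cs i) (g, h).
    by apply: eq_bigr => i _; rewrite ffunE.
  by rewrite -ht !ffunE sum_ffunE addrC subrK.
have hd' : derivation rV psi c' tau'.
  move=> g h; rewrite /tau' hd hc' psiM mulmxDl; row_ring.
pose delta i f := (cover_map f).2 i.
(* The coefficients [a i] produce the cocycle [c']; the remaining ones are the entries of [tau'] at
   the generators, where the cocycle coordinates contribute nothing. *)
pose v (i : I) : 'F_p := match i with inl i => a i | inr jb => tau' (fgen jb.1) 0 jb.2 end.
have hv : derivation rV psi c' (fun f => \sum_i v i *: delta i f).
  have := derivation_sum v hD => h g1 g2; rewrite h; congr (_ + _).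
  rewrite big_sumType /= [X in _ + X]big1 ?addr0 // => -[j b] _.
  by rewrite /= ffunE scaler0.
have E1 : tau' =1 (fun f => \sum_i v i *: delta i f).
  apply: (derivation_unique psiM hd' hv) => j; rewrite big_sumType /=.
  rewrite {1}/delta /cover_map weval_fgen /= big1 ?add0r => [|i _]; last first.
    by rewrite ffunE scaler0.
  rewrite (eq_bigr (fun jb : 'I_e * 'I_d => (fun j' b =>
      if j == j' then tau' (fgen j) 0 b *: delta_mx 0 b else 0) jb.1 jb.2)).
    rewrite -(pair_bigA _ (fun j' b =>
      if j == j' then tau' (fgen j) 0 b *: delta_mx 0 b else 0)) /=.
    rewrite (bigD1 j) //= [X in _ + X]big1 ?addr0 => [|j' nj].
      rewrite [LHS]row_sum_delta; apply: eq_bigr => b _; by rewrite eqxx.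
    by apply: big1 => b _; rewrite eq_sym (negPf nj).
  move=> [j' b] _ /=; rewrite /delta /cover_map weval_fgen /= ffunE.
  by case: eqP => [<-|] //; rewrite scaler0.
(* Since [cover_map] takes the same value at [f] and at [1], so do [tau'], [tau] and finally
   [phi]. *)
have := E1 f; have := E1 1%g; rewrite /delta hf.
rewrite -[cover_map 1%g]/(weval _ [::]) weval_nil => <-.
rewrite /tau' (hom1 psiM) -cover_map1 hf /= => /addIr.
rewrite !htau ?(hom1 psiM) //; last by rewrite -cover_map1 hf.
by move=> ->; apply: equivariant1 hphi.
Qed.

End Kernel.

(** * Independence of the epimorphism *)

Section Independence.
Variables psi0 psi : F -> gT.
Hypotheses (psi0M : {morph psi0 : f g / (f * g)%g})
  (psiM : {morph psi : f g / (f * g)%g}).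
Hypotheses (psi0_surj : forall h, exists f, psi0 f = h)
  (psi_surj : forall h, exists f, psi f = h).

Local Notation gens psi := (cover_gen (psi \o @fgen e)).

(** Gaschutz's lemma, applied to the image of the cover map of [psi], replaces its generators by a
    tuple over those of [psi0]. The kernel of the cover map of [psi0] dies under any such tuple. *)
Lemma cover_lift : exists2 t : 'I_e -> E,
  tuple_gen t = tuple_gen (gens psi) &
  forall f : F, cover_map psi0 f = 1%g -> weval t f = 1%g.
Proof.
have [|t [ht1 ht2]] := @gaschutz _ _ (fun x : E => x.1) e ext_fstM
  (psi0 \o @fgen e) (finfun (gens psi)) _ (tuple_gen_surj psi0M psi0_surj).
  rewrite -(tuple_gen_surj psiM psi_surj); congr tuple_gen.
  by apply/funext => i; rewrite ffunE.
exists t; first by rewrite ht2; congr tuple_gen; apply/funext => i; rewrite ffunE.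
move=> f /(cover_mapP psi0M psi0_surj) hf.
by apply: (equivariant_kernel_weval psi0M) hf => j; rewrite ht1.
Qed.

(* Sends the value of a word in the cover of [psi0] to its value under [t]. *)
Definition cover_comparison (t : 'I_e -> E) (g : E) : E :=
  weval t (xget (1%g : F) [set f | cover_map psi0 f = g]%classic).

Lemma cover_comparisonE (t : 'I_e -> E) :
  (forall f : F, cover_map psi0 f = 1%g -> weval t f = 1%g) ->
  forall f : F, cover_comparison t (cover_map psi0 f) = weval t f.
Proof.
move=> ht f; rewrite /cover_comparison; case: xgetP => [f' _ /= hf'|]; last by move=> /(_ f) [].
apply/eqP; rewrite eq_mulVg1 -wevalV -wevalM; apply/eqP/ht.
by rewrite cover_mapM (homV (@cover_mapM psi0)) hf' mulVg.
Qed.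

Lemma cover_comparison_onto (t : 'I_e -> E) :
  (forall f : F, cover_map psi0 f = 1%g -> weval t f = 1%g) ->
  cover_comparison t @: tuple_gen (gens psi0) = tuple_gen t.
Proof.
move=> ht; apply/setP => g; apply/imsetP/idP => [[h + ->]|/tuple_genP[f <-]].
  case/tuple_genP => f <-; rewrite -/(cover_map psi0 f) cover_comparisonE //.
  by apply/tuple_genP; exists f.
exists (cover_map psi0 f); last by rewrite cover_comparisonE.
by apply/tuple_genP; exists f.
Qed.

(** The comparison maps the image for [psi0] onto the image for [psi]. As the statement is symmetric
    in the two, the images have equal order. *)
Lemma leq_card_cover : (#|tuple_gen (gens psi)| <= #|tuple_gen (gens psi0)|)%N.
Proof.
have [t <- ht] := cover_lift.
by rewrite -(cover_comparison_onto ht) leq_imset_card.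
Qed.

End Independence.

(** Preimages [y] of the lifted tuple form a new system of generators modulo the kernel for [psi],
    and on it the relations are those of [psi0]. So relators found for one epimorphism present the
    cover for all. *)
Theorem equivariant_kernel_transfer (psi0 psi : F -> gT) :
  {morph psi0 : f g / (f * g)%g} -> {morph psi : f g / (f * g)%g} ->
  (forall h, exists f, psi0 f = h) -> (forall h, exists f, psi f = h) ->
  exists y : 'I_e -> F,
    (forall w : F, equivariant_kernel rV psi (weval y w) <->
                   cover_map psi0 w = 1%g) /\
    forall f, exists w : F, equivariant_kernel rV psi ((weval y w)^-1 * f)%g.
Proof.
move=> psi0M psiM surj0 surj.
have [t tE ht] := cover_lift psi0M psiM surj0 surj.
(* The cardinal inequality with the roles exchanged turns the surjective comparison into an
   injective one. *)
have /imset_injP injm : (#|cover_comparison psi0 t @: tuple_gen (cover_gen (psi0 \o @fgen e))|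
   == #|tuple_gen (cover_gen (psi0 \o @fgen e))|)%N.
  rewrite eqn_leq leq_imset_card (cover_comparison_onto ht) tE.
  exact: leq_card_cover.
have kert f : weval t (fword f) = 1%g <-> cover_map psi0 f = 1%g.
  split; last exact: ht.
  rewrite -(cover_comparisonE ht) => hf.
  have map1 : cover_map psi0 1%g = 1%g by apply: weval_nil.
  rewrite -map1; apply: injm; try by apply/tuple_genP; eexists.
  by rewrite hf cover_comparisonE // [RHS]weval_nil.
have /choice[y hy] : forall j, exists f : F, cover_map psi f = t j.
  move=> j; apply/tuple_genP; rewrite -tE; apply/tuple_genP.
  by exists (fgen j); rewrite weval_fgen.
have hyw (w : F) : cover_map psi (weval y w) = weval t w.
  rewrite (hom_wevalE (@cover_mapM psi)); congr weval; exact/funext.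
exists y; split=> [w|f].
  by rewrite -(cover_mapP psiM surj) hyw.
have : cover_map psi f \in tuple_gen t by rewrite tE; apply/tuple_genP; exists f.
case/tuple_genP => w hw; exists w; apply/(cover_mapP psiM surj).
apply: (mulgI (cover_map psi (weval y w))).
by rewrite -cover_mapM mulKVg mulg1 hyw.
Qed.

End CoverExtension.

(** * The kernel of the cover *)

Section CoverKernel.
Variables (p d e : nat) (gT : finGroupType).
Variable rV : mx_representation 'F_p [set: gT]%G d.
Hypotheses (p_prime : prime p) (irrV : mx_irreducible rV).
Local Notation F := (free_group e).
Local Notation V := 'rV['F_p]_d.
Local Open Scope ring_scope.

(** Over the prime field scalars act by repeated addition, so a stable additive subgroup is a
    submodule. *)
Lemma irreducible_stable (U : set V) (u : V) :
  (forall v w, U v -> U w -> U (v - w)) ->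
  (forall v h, U v -> U (v *m rV h)) -> U u -> u != 0 -> forall v, U v.
Proof.
move=> UB UJ Uu u0 v.
have U0 : U 0 by rewrite -(subrr u); apply: UB.
have UD x y : U x -> U y -> U (x + y).
  by move=> Ux Uy; rewrite -[y]opprK; apply: (UB) => //; rewrite -sub0r; apply: UB.
have UZ (a : 'F_p) x : U x -> U (a *: x).
  move=> Ux; rewrite -[a]natr_Zp scaler_nat; elim: (nat_of_ord a) => // m IH.
  by rewrite mulrS; apply: UD.
(* The span of [U] as a row space, the form in which irreducibility is stated; by closure it has no
   vectors outside [U]. *)
pose W : 'M['F_p]_d := (\sum_(x : V | `[< U x >]) <<x>>)%MS.
have inW x : (x <= W)%MS -> U x.
  case/sub_sumsmxP => c ->.
  apply: (big_ind U) => // y /asboolP Uy.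
  have : (c y *m <<y>> <= y)%MS by rewrite -(genmxE y) submxMl.
  by case/sub_rVP => a ->; apply: UZ.
have Win x : U x -> (x <= W)%MS.
  by move=> Ux; apply: (sumsmx_sup x); [apply/asboolP | rewrite genmxE].
have [_ _ /(_ W) h] := irrV.
apply: inW; apply: submx_trans (submx1 _) (h _ (submx1 _) _).
  apply/mxmoduleP => g _; rewrite sumsmxMr; apply/sumsmx_subP => y /asboolP Uy.
  rewrite (eqmxMr _ (genmxE y)); apply: Win; exact: UJ.
by apply: contraNneq u0 => W0; rewrite -submx0 -W0; apply: Win.
Qed.

Section FixedHom.
Variable psi : {multiplicative F -> gT}.
Let psiM : {morph psi : f g / (f * g)%g} := @gmulfM _ _ psi.
Let psi1 := hom1 psiM.
Let psiV := homV psiM.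
Local Notation K := (equivariant_kernel rV psi).

Lemma equivariant_kernel_normal : is_normal_subgroup (K : set F).
Proof.
split; first split.
- by split=> // phi; apply: (equivariant1 psiM).
- move=> f g [hf kf] [hg kg]; split; first by rewrite psiM psiV hf hg mulgV.
  move=> phi hphi; rewrite hphi.1 // ?psiV ?hg ?invg1 // (equivariantV psiM hphi) //.
  by rewrite kf // kg // subrr.
- move=> f g [hf kf]; split; first by rewrite (homJ psiM) hf conj1g.
  by move=> phi hphi; rewrite hphi.2 // kf // mul0mx.
Qed.

Lemma equivariant_kernelM f g : K f -> K g -> K (f * g)%g.
Proof.
have [[h1 h] _] := equivariant_kernel_normal => kf kg.
by rewrite -[g]invgK -[g^-1%g]mul1g; apply: (h) => //; apply: h.
Qed.

(** The target [V] is abelian of exponent [p], so homomorphisms to it kill commutators and [p]-th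
    powers of the kernel. *)
Lemma cker_p_equivariant : (cker_p p psi `<=` K)%classic.
Proof.
have [KS _] := equivariant_kernel_normal.
move=> _ [a ha] [b hb] <-; apply: equivariant_kernelM.
  apply: (ha (K : set F)); split=> // _ [x hx] [y hy] <-.
  rewrite /cker /= in hx hy.
  rewrite (_ : [~ x, y] = x^-1 * x ^ y)%g //.
  split; first by rewrite psiM psiV (homJ psiM) hx hy conj1g invg1 mulg1.
  move=> phi hphi; rewrite hphi.1 ?psiV ?(homJ psiM) ?hx ?invg1 ?conj1g //.
  by rewrite hphi.2 // hy repr_mx1T mulmx1 (equivariantV psiM hphi) // addrC subrr.
apply: (hb (K : set F)); split=> // _ [x hx] <-; rewrite /cker /= in hx.
have hxn m : psi (x ^+ m)%g = 1%g.
  by elim: m => [|m IH]; rewrite ?expgS ?psiM ?hx ?IH ?mulg1.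
split=> // phi hphi.
have phiX m : phi (x ^+ m)%g = phi x *+ m.
  elim: m => [|m IH]; first by rewrite expg0 mulr0n (equivariant1 psiM hphi).
  by rewrite expgS hphi.1 // IH mulrS.
by rewrite phiX -scaler_nat (pcharf0 (pchar_Fp p_prime)) scale0r.
Qed.

Lemma to_pcoverE f g : to_pcover p psi f = to_pcover p psi g -> K (f^-1 * g)%g.
Proof.
move=> /qprojE h; apply: (h (K : set F)); split.
  exact: equivariant_kernel_normal.
exact: cker_p_equivariant.
Qed.


(** * Finite separating families and the radical *)

Section MinimalFamily.
Variables (J : finType) (phi0 : J -> F -> V).
Hypothesis psi_surj : forall h, exists f, psi f = h.
Hypothesis phi0_eq : forall j, equivariant rV psi (phi0 j).
Hypothesis phi0_sep : forall f,
  psi f = 1%g -> (forall j, phi0 j f = 0) -> K f.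

(* In a separating family of least size no member can be dropped, so by
   irreducibility the members take independent values. *)
Lemma independent_family : exists k (phi : 'I_k -> F -> V),
  [/\ forall i, equivariant rV psi (phi i),
      forall f, psi f = 1%g -> (forall i, phi i f = 0) -> K f &
      forall A : 'M['F_p]_(k, d), exists2 f, psi f = 1%g &
        forall i, phi i f = row i A].
Proof.
pose Q k := exists phi : 'I_k -> F -> V,
  (forall i, equivariant rV psi (phi i)) /\
  (forall f, psi f = 1%g -> (forall i, phi i f = 0) -> K f).
have exQ : exists k, `[< Q k >].
  exists #|J|; apply/asboolP; exists (fun i => phi0 (enum_val i)); split=> // f hf h.
  by apply: phi0_sep => // j; rewrite -(enum_rankK j).
have [k /asboolP[phi [phiE phiS]] kmin] := ex_minnP exQ.
exists k, phi; split=> //.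
have single i v : exists2 f, psi f = 1%g & forall j, phi j f = if j == i then v else 0.
  have [f hf [fi fj]] : exists2 f, psi f = 1%g &
      phi i f != 0 /\ forall j, j != i -> phi j f = 0.
    (* Otherwise, on the kernel, the vanishing of the other members forces that of [phi i]; omitting
       it leaves a shorter separating family, against minimality. *)
    apply: contrapT => hU.
    case: k phi phiE phiS kmin i hU => [|k] phi phiE phiS kmin i hU; first by case: (i).
    have : Q k.
      exists (fun j => phi (lift i j)); split=> // f hf h; apply: phiS => // j.
      have [->|] := eqVneq j i; last by rewrite eq_sym => /unlift_some[j' -> _]; exact: h.
      apply: contrapT => /eqP nz; apply: hU; exists f => //; split=> // j'.
      by rewrite eq_sym => /unlift_some[l -> _].
    by move/asboolP/kmin; rewrite ltnn.
  (* The values that [phi i] takes where all other members vanish form a nonzero submodule, hence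
     everything. *)
  pose U : set V := fun v => exists2 f, psi f = 1%g &
    forall j, phi j f = if j == i then v else 0.
  apply: (irreducible_stable (U := U)) fi v.
  - move=> v w [f1 hf1 fE] [g hg gE]; exists (f1 * g^-1)%g.
      by rewrite psiM psiV hf1 hg mulgV.
    move=> j; rewrite (phiE j).1 ?psiV ?hg ?invg1 // (equivariantV psiM (phiE j)) //.
    by rewrite fE gE; case: eqP; rewrite ?subr0.
  - move=> v h [f1 hf1 fE]; have [g <-] := psi_surj h; exists (f1 ^ g)%g.
      by rewrite (homJ psiM) hf1 conj1g.
    by move=> j; rewrite (phiE j).2 // fE; case: eqP; rewrite ?mul0mx.
  - by exists f => // j; case: eqP => [->|/eqP/fj].
move=> A.
suff [f hf hA] : exists2 f, psi f = 1%g &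
    forall i, phi i f = if i \in enum 'I_k then row i A else 0.
  by exists f => // i; rewrite hA mem_enum.
elim: (enum 'I_k) (enum_uniq 'I_k) => [_|j s IH /= /andP[js /IH[f hf hA]]].
  by exists 1%g => // i; exact: (equivariant1 psiM).
have [g hg gE] := single j (row j A).
exists (f * g)%g; first by rewrite psiM hf hg mulg1.
move=> i; rewrite (phiE i).1 // hA gE inE.
by have [->|] := eqVneq i j; rewrite ?(negPf js) ?add0r //= addr0.
Qed.

Lemma to_pcoverM : {morph to_pcover p psi : f g / (f * g)%g}.
Proof. exact: qprojM. Qed.

Lemma to_pcover_surj y : exists f, to_pcover p psi f = y.
Proof. by exists (generic_quotient.repr y); apply: qproj_repr. Qed.

Lemma submodule_normal W : is_submodule (p := p) (psi := psi) W ->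
  is_normal_subgroup W.
Proof.
by move=> [sW _ hW]; split=> // x y Wx; have [f <-] := to_pcover_surj y; exact: hW.
Qed.

Lemma normal_closure_id (G : groupType) (A : set G) x :
  is_normal_subgroup A -> normal_closure A x -> A x.
Proof. by move=> hA; apply; split. Qed.

(** If the quotient by [W] is a sum of copies of [V], each row of the isomorphism [theta] is a
    homomorphism to [V]. An element of [K] has all rows zero, so it lies in [W]. *)
Lemma radical_equivariant_kernel f : K f -> Vradical rV (psi := psi) (to_pcover p psi f).
Proof.
move=> kf W [[Wsub [k [theta [[_ thI _] thM thJ]]]] _].
pose q f := qproj W (to_pcover p psi f).
have qM : {morph q : f g / (f * g)%g} by move=> f1 g; rewrite /q to_pcoverM qprojM.
have Bq a : psi a = 1%g -> (qproj W @` @pmodule p e gT psi)%classic (q a).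
  by move=> ha; exists (to_pcover p psi a) => //; exists a.
have thetaE i : equivariant rV psi (fun f => row i (theta (q f))).
  split=> [a b ha hb|a g ha]; first by rewrite qM thM ?linearD //; apply: Bq.
  by rewrite (homJ qM) thJ ?row_mul //; apply: Bq.
have th0 : theta (q f) = theta (q 1%g).
  apply/row_matrixP => i; apply: etrans (kf.2 _ (thetaE i)) _.
  exact: esym (equivariant1 psiM (thetaE i)).
have /esym/qprojE := thI _ _ (mem_set (Bq f kf.1)) (mem_set (Bq _ psi1)) th0.
rewrite -(homV to_pcoverM) -to_pcoverM invg1 mul1g.
exact: normal_closure_id (submodule_normal Wsub).
Qed.

(** The matrix with rows [phi i], for an independent family, identifies the kernel modulo [K] with a
    sum of copies of [V]: separation gives injectivity and independence surjectivity. *)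
Lemma equivariant_kernel_homogeneous :
  homogeneous_quotient rV (psi := psi) (to_pcover p psi @` K)%classic.
Proof.
have [[K1 KB] KJ] := equivariant_kernel_normal.
set W := (_ @` _)%classic.
have subW : is_submodule (p := p) (psi := psi) W.
  split; [split| |].
  - by exists 1%g => //; exact: hom1 to_pcoverM.
  - move=> _ _ [f kf <-] [g kg <-]; exists (f * g^-1)%g; first exact: KB.
    by rewrite to_pcoverM (homV to_pcoverM).
  - by move=> _ [f [hf _] <-]; exists f.
  - move=> _ g [f kf <-]; exists (f ^ g)%g; first exact: KJ.
    by rewrite (homJ to_pcoverM).
split=> //.
have [k [phi [phiE phiS phiA]]] := independent_family.
pose q f := qproj W (to_pcover p psi f).
have qM : {morph q : f g / (f * g)%g} by move=> f1 g; rewrite /q to_pcoverM qprojM.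
have qK f g : q f = q g <-> K (f^-1 * g)%g.
  split=> [/qprojE/(normal_closure_id (submodule_normal subW))|h].
    rewrite -(homV to_pcoverM) -to_pcoverM => -[m km /to_pcoverE hm].
    by have := equivariant_kernelM km hm; rewrite mulKVg.
  apply/qprojE => A [hA]; apply; exists (f^-1 * g)%g => //.
  by rewrite to_pcoverM (homV to_pcoverM).
pose mat f : 'M['F_p]_(k, d) := \matrix_i phi i f.
(* A preimage in the kernel is chosen, with [1] as default; [thetaE] shows that the choice is
   immaterial. *)
pose theta (x : quot W) := mat (xget (1%g : F) [set f | psi f = 1%g /\ q f = x]%classic).
have thetaE f : psi f = 1%g -> theta (q f) = mat f.
  move=> hf; rewrite /theta; case: xgetP => [g _ [hg /qK kg]|]; last first.
    by move=> /(_ f) [].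
  apply/row_matrixP => i; rewrite !rowK.
  have := kg.2 _ (phiE i); rewrite (phiE i).1 ?psiV ?hg ?invg1 //.
  rewrite (equivariantV psiM (phiE i)) // addrC => /eqP; rewrite subr_eq0 => /eqP.
  exact: esym.
exists k, theta; split; first split.
- by [].
- move=> x y; rewrite !inE => -[_ [f hf <-] <-] [_ [g hg <-] <-].
  rewrite /= -!/(q _) !thetaE // => /row_matrixP hfg.
  have psifg : psi (f^-1 * g)%g = 1%g by rewrite psiM psiV hf hg mulg1 invg1.
  apply/qK; apply: phiS => // i.
  rewrite (phiE i).1 ?psiV ?hf ?invg1 // (equivariantV psiM (phiE i)) //.
  by have := hfg i; rewrite !rowK => ->; rewrite addrC subrr.
- move=> A _; have [f hf hA] := phiA A; exists (q f).
    by exists (to_pcover p psi f) => //; exists f.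
  by rewrite thetaE //; apply/row_matrixP => i; rewrite rowK hA.
- move=> _ _ [_ [f hf <-] <-] [_ [g hg <-] <-].
  rewrite -!/(q _) -qM !thetaE ?psiM ?hf ?hg ?mulg1 //.
  by apply/row_matrixP => i; rewrite linearD /= !rowK (phiE i).1.
- move=> _ g [_ [f hf <-] <-]; rewrite /= -!/(q _) -(homJ qM) !thetaE //.
    by apply/row_matrixP => i; rewrite row_mul !rowK (phiE i).2.
  by rewrite (homJ psiM) hf conj1g.
Qed.

(** The image of [K] is one of the submodules being intersected and lies in all of them, so it is
    the radical. *)
Theorem Vcover_kernel f :
  qproj (Vradical rV (psi := psi)) (to_pcover p psi f) = 1%g <-> K f.
Proof.
split=> [/esym/qprojE h|kf].
  have : (to_pcover p psi @` K)%classic (to_pcover p psi f).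
    have := h _; rewrite invg1 mul1g; apply; split.
      by apply: submodule_normal; have [] := equivariant_kernel_homogeneous.
    by apply: smallest_sub => //; exact: equivariant_kernel_homogeneous.
  case=> m km /to_pcoverE hm.
  by have := equivariant_kernelM km hm; rewrite mulKVg.
apply/esym/qprojE; rewrite invg1 mul1g => A [_]; apply.
exact: radical_equivariant_kernel.
Qed.

End MinimalFamily.

End FixedHom.
End CoverKernel.

(** * A finite presentation of the cover *)

Section CoverPresentation.
Variables (p d e r : nat) (gT : finGroupType).
Variable rV : mx_representation 'F_p [set: gT]%G d.
Hypotheses (p_prime : prime p) (irrV : mx_irreducible rV).
Variable cs : 'I_r -> cochain2 p d gT.
Hypothesis cs_basis : H2_basis rV cs.
Local Notation F := (free_group e).

Lemma card_cover_extension :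
  #|{: extension (cover_family e cs_basis)}| = (#|gT| * p ^ ((r + e * d) * d))%N.
Proof.
rewrite card_prod card_ffun card_mx card_Fp // mul1n.
by rewrite card_sum card_prod !card_ord -expnM [(d * (_ + _))%N]mulnC.
Qed.

(** The relators depend on [h0] alone, while [psi] is arbitrary. The generators presented are
    therefore the images of the transferred tuple [y] and not those of the free generators. *)
Theorem cover_presentation (h0 : 'I_e -> gT) (B : nat) (R : seq (word e)) :
  tuple_gen h0 = [set: gT]%SET ->
  (#|gT| * p ^ ((r + e * d) * d) <= B)%N ->
  (forall w, (size w <= B)%N ->
    weval (cover_gen cs_basis h0) (positive w) = 1%g -> positive w \in R) ->
  (forall w, w \in R -> weval (cover_gen cs_basis h0) w = 1%g) ->
  forall psi : {multiplicative F -> gT}, (forall h, exists f, psi f = h) ->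
  presents_group (Tagged (fun n => seq (word n)) R) (Vcover rV psi).
Proof.
move=> gen0 hB R1 R2 psi surj.
pose psi0 (f : F) := weval h0 f.
have psi0M : {morph psi0 : f g / (f * g)%g} by move=> f g; apply: wevalM.
have surj0 h : exists f, psi0 f = h.
  by apply/tuple_genP; rewrite gen0 inE.
have h0E : psi0 \o @fgen e = h0 by apply/funext => j; apply: weval_fgen.
have psiM : {morph psi : f g / (f * g)%g} := @gmulfM _ _ psi.
have [y [y1 y2]] := equivariant_kernel_transfer cs_basis psi0M psiM surj0 surj.
(* The coordinates of [cover_map], shifted to vanish at [1], form the finite separating family from
   which the finite number of copies of [V] comes. *)
pose phi i f := ((cover_map cs_basis psi f).2 i - (cover_map cs_basis psi 1%g).2 i)%R.
have [_ hD] := @ext_derivation _ _ _ _ _ _ _ cs_basis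
  (cover_gen cs_basis (psi \o @fgen e)) psi psiM (fun=> erefl).
have phiE i : equivariant rV psi (phi i).
  by have h := derivation_equivariant psiM (hD i); exact h.
have phiS f : psi f = 1%g -> (forall i, phi i f = 0%R) -> equivariant_kernel rV psi f.
  move=> hf h; apply/(cover_mapP cs_basis psiM surj).
  rewrite -[RHS](weval_nil (cover_gen cs_basis (psi \o @fgen e))).
  rewrite -[RHS]/(cover_map cs_basis psi 1%g).
  rewrite [LHS]surjective_pairing [RHS]surjective_pairing !cover_map1 // hf (hom1 psiM).
  by congr pair; apply/ffunP => i; apply/eqP; rewrite -GRing.subr_eq0; apply/eqP/h.
have kerE := Vcover_kernel p_prime irrV surj phiE phiS.
pose Q (f : F) : Vcover rV psi := qproj (Vradical rV (psi := psi)) (to_pcover p psi f).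
have QM : {morph Q : f g / (f * g)%g} by move=> f g; rewrite /Q to_pcoverM qprojM.
have QE f : Q f = 1%g <-> equivariant_kernel rV psi f := kerE f.
exists (Q \o y); split.
  move=> g; pose a := generic_quotient.repr g.
  have [f hf] : exists f, Q f = g.
    by have [f hf] := to_pcover_surj a; exists f; rewrite /Q hf qproj_repr.
  have [w hw] := y2 f; exists (fword w); rewrite -hf -(hom_wevalE QM).
  move/QE: hw; rewrite QM (homV QM) => hw.
  by apply: (mulgI (Q (weval y w))^-1%g); rewrite hw mulVg.
move=> w; rewrite -(hom_wevalE QM) QE y1 /cover_map h0E.
apply: (@short_relators _ _ _ B).
- by rewrite card_cover_extension.
- by move=> u hu hw; exact: R1.
- by move=> u; exact: R2.
Qed.

End CoverPresentation.

(** * Correctness of the algorithm *)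

Definition erase n (w : word n) : raw_word := [seq (nat_of_ord l.1, l.2) | l <- w].

Definition raw_mx p m n (A : 'M['F_p]_(m, n)) : seq (seq nat) :=
  [seq [seq nat_of_ord (A i j) | j <- enum 'I_n] | i <- enum 'I_m].

Definition raw_cochain n p d (t : cochain_table n p d) : raw_table :=
  [seq (erase y.1.1, (erase y.1.2, (raw_mx y.2, tt))) | y <- t].

Definition raw_input e p n (R : seq (word n)) d (mats : 'I_n -> 'M['F_p]_d) r
    (ts : 'I_r -> cochain_table n p d) : input :=
  (e, (p, ((n, map (@erase n) R),
    (d, ([seq raw_mx (mats i) | i <- enum 'I_n],
      ([seq raw_cochain (ts j) | j <- enum 'I_r], tt)))))).

Lemma enc_seq_map (T S : Type) {cS : codable S} (enc : T -> data) (f : T -> S) s :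
  (forall y, enc y = code (f y)) -> enc_seq enc s = code (map f s).
Proof. by move=> h; rewrite /code /seq_codable; elim: s => //= a s ->; rewrite h. Qed.

Lemma enc_wordE n (w : word n) : enc_word w = code (erase w).
Proof. by apply: enc_seq_map => -[i b]. Qed.

Lemma enc_mxE p m n (A : 'M['F_p]_(m, n)) : enc_mx A = code (raw_mx A).
Proof. by apply: enc_seq_map => i; apply: enc_seq_map. Qed.

Lemma enc_presentationE n (R : seq (word n)) :
  enc_presentation (Tagged (fun n => seq (word n)) R) = code (n, map (@erase n) R).
Proof. by congr Node; apply: enc_seq_map => w; apply: enc_wordE. Qed.

Lemma enc_inputE e p n (R : seq (word n)) d (mats : 'I_n -> 'M['F_p]_d) r
    (ts : 'I_r -> cochain_table n p d) :
  enc_input e p R mats ts = code (raw_input e R mats ts).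
Proof.
rewrite /enc_input /enc_tuple /= enc_presentationE.
do 4 congr Node; congr Node; first by apply: enc_seq_map => i; apply: enc_mxE.
congr Node; apply: enc_seq_map => j; apply: enc_seq_map => -[[u v] a] /=.
by rewrite !enc_wordE enc_mxE.
Qed.

Lemma raw_winv_erase n (w : word n) : raw_winv (erase w) = erase (winv w).
Proof. by rewrite /raw_winv /winv /erase map_rev -!map_comp. Qed.

Lemma raw_push_erase n (l : letter n) (w : word n) :
  raw_push (nat_of_ord l.1, l.2) (erase w) = erase (push l w).
Proof.
case: w => [|l' w] //=; rewrite /raw_push /=.
have -> : (l'.1 == l.1 :> nat) && (if l.2 then ~~ l'.2 else l'.2) = (l' == linv l).
  by case: l l' => i b [i' b']; rewrite /linv xpair_eqE /=; case: b; case: b'.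
by case: eqP.
Qed.

Lemma free_reduce_erase n (w : word n) : free_reduce (erase w) = erase (wmul w [::]).
Proof. by elim: w => // l w IH; rewrite /= IH raw_push_erase. Qed.

(** * Evaluation of raw words and soundness of derivations *)

Section RawEvaluation.
Variables (n : nat) (gT : groupType) (x : 'I_n -> gT).
Local Open Scope group_scope.

(* Letters out of range, which a certificate may contain, have value [1]. *)
Definition raw_gen (j : nat) : gT := if insub j is Some i then x i else 1.

Definition raw_leval (l : raw_letter) : gT :=
  if l.2 then (raw_gen l.1)^-1 else raw_gen l.1.

Definition raw_eval (w : raw_word) : gT := \prod_(l <- w) raw_leval l.

Lemma raw_eval_nil : raw_eval [::] = 1.
Proof. by rewrite /raw_eval big_nil. Qed.

Lemma raw_eval_cons l w : raw_eval (l :: w) = raw_leval l * raw_eval w.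
Proof. by rewrite /raw_eval big_cons. Qed.

Lemma raw_eval_cat u v : raw_eval (u ++ v) = raw_eval u * raw_eval v.
Proof. by rewrite /raw_eval big_cat. Qed.

Lemma raw_gen_ord (i : 'I_n) : raw_gen i = x i.
Proof. by rewrite /raw_gen valK. Qed.

Lemma raw_eval_erase w : raw_eval (erase w) = weval x w.
Proof.
elim: w => [|l w IH]; first by rewrite raw_eval_nil weval_nil.
by rewrite /= raw_eval_cons IH weval_cons /raw_leval /leval raw_gen_ord.
Qed.

Lemma raw_leval_inv l : raw_leval (raw_inv l) = (raw_leval l)^-1.
Proof. by case: l => j []; rewrite /raw_leval /= ?invgK. Qed.

Lemma raw_eval_winv w : raw_eval (raw_winv w) = (raw_eval w)^-1.
Proof.
rewrite /raw_winv; elim: w => [|l w IH]; first by rewrite raw_eval_nil invg1.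
rewrite map_cons rev_cons -cats1 raw_eval_cat IH !raw_eval_cons raw_eval_nil.
by rewrite mulg1 raw_leval_inv invgM.
Qed.

Lemma raw_eval_push l w : raw_eval (raw_push l w) = raw_leval l * raw_eval w.
Proof.
case: w => [|l' w]; rewrite /raw_push /=; first by rewrite raw_eval_cons.
case: ifP => [|_]; last by rewrite !raw_eval_cons.
case: l l' => j b [j' b'] /= /andP[/eqP -> hb].
rewrite raw_eval_cons (_ : (j, b') = raw_inv (j, b)); last first.
  by rewrite /raw_inv /=; case: b hb; case: b'.
by rewrite raw_leval_inv mulVKg.
Qed.

Lemma raw_eval_reduce w : raw_eval (free_reduce w) = raw_eval w.
Proof. by elim: w => //= l w IH; rewrite raw_eval_push IH raw_eval_cons. Qed.

Lemma raw_eval_consequence (R : seq (word n)) D :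
  (forall r, r \in R -> weval x r = 1) ->
  raw_eval (consequence (map (@erase n) R) D) = 1.
Proof.
move=> hR; rewrite /consequence; elim: D => [|[g [k b]] D IH] /=.
  exact: raw_eval_nil.
have hk : raw_eval (nth [::] (map (@erase n) R) k) = 1.
  have [kR|kR] := ltnP k (size R); last by rewrite nth_default ?size_map ?raw_eval_nil.
  by rewrite (nth_map [::]) // raw_eval_erase hR // mem_nth.
rewrite !raw_eval_cat IH raw_eval_winv mulg1.
have -> : raw_eval (if b then raw_winv (nth [::] (map (@erase n) R) k)
  else nth [::] (map (@erase n) R) k) = 1.
  by case: b; rewrite ?raw_eval_winv hk ?invg1.
by rewrite mul1g mulVg.
Qed.

Lemma derivable_sound (R : seq (word n)) ds u v :
  (forall r, r \in R -> weval x r = 1) ->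
  derivable (map (@erase n) R) ds u v -> raw_eval u = raw_eval v.
Proof.
move=> hR /hasP[D _ /nilP/(congr1 raw_eval)].
rewrite raw_eval_reduce !raw_eval_cat raw_eval_winv raw_eval_consequence //.
rewrite mul1g raw_eval_nil => h.
by apply: (mulIg (raw_eval v)^-1); rewrite h mulgV.
Qed.

End RawEvaluation.

(** * The group behind a verified table *)

Section RegularAction.
Variables (n e : nat) (H : finGroupType) (x : 'I_n -> H) (R : seq (word n)).
Hypothesis presR : presents x R.
Variables (ts : seq raw_word) (tbl : seq (seq (nat * nat)))
  (ds : seq (seq (raw_word * raw_letter))) (ws qs : seq (seq nat)).
Hypothesis checked : check e n (map (@erase n) R) (ts, (tbl, (ds, (ws, qs)))).
Local Notation N := (size ts).
Local Notation tact i w := (act_word tbl i (erase w)).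

Lemma relator_trivial r : r \in R -> weval x r = 1.
Proof.
move=> rR; rewrite -(weval_weval x r); apply/presR.2 => A [hA]; apply.
by exists r.
Qed.

Let N_gt0 : 0 < N. Proof. by case/and3P: checked. Qed.

Lemma check_letterP i (l : letter n) : i < N ->
  check_letter (map (@erase n) R) ts tbl ds i (nat_of_ord l.1, l.2).
Proof.
move=> iN; case/and3P: checked => _ /= /allP/(_ i) + _.
rewrite mem_iota iN => /(_ isT)/andP[_ /allP/(_ l.1)].
by rewrite mem_iota ltn_ord => /(_ isT)/andP[]; case: l => j [].
Qed.

Lemma relator_fixes i r : i < N -> r \in R -> tact i r = i.
Proof.
move=> iN rR; case/and3P: checked => _ /= /allP/(_ i) + _.
rewrite mem_iota iN => /(_ isT)/andP[/allP/(_ (erase r)) + _].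
by rewrite map_f // => /(_ isT)/eqP.
Qed.

Lemma tact_ltn i (w : word n) : i < N -> tact i w < N.
Proof.
elim: w i => //= l w IH i iN; apply: IH.
by case/and3P: (check_letterP l iN).
Qed.

Lemma tact_cat i (u v : word n) : tact i (u ++ v) = tact (tact i u) v.
Proof. by rewrite /erase map_cat /act_word foldl_cat. Qed.

Lemma tact_push i l (w : word n) : i < N -> tact i (push l w) = tact i (l :: w).
Proof.
move=> iN; case: w => [|l' w] //=; case: eqP => [->|//].
by have /and3P[_ /eqP] := check_letterP l iN; rewrite /raw_inv /= => ->.
Qed.

Lemma tact_wmul i (u v : word n) : i < N ->
  tact i (wmul u v) = tact (tact i u) v.
Proof.
elim: u i => //= l u IH i iN; rewrite tact_push //= IH //.
exact: (@tact_ltn i [:: l]).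
Qed.

Lemma tact_winv i (w : word n) : i < N -> tact (tact i w) (winv w) = i.
Proof.
rewrite /winv; elim: w i => //= l w IH i iN.
rewrite rev_cons -cats1 tact_cat /= IH; last exact: (@tact_ltn i [:: l]).
by have /and3P[_ /eqP] := check_letterP l iN.
Qed.

Lemma tact_wfree i (w : word n) : i < N -> tact i (weval (@fgen n) w) = tact i w.
Proof. by move=> iN; rewrite weval_free tact_wmul. Qed.

(** The elements fixing all points form a normal subgroup containing the relators, hence the whole
    kernel of the presentation. *)
Lemma kernel_fixes (f : free_group n) : weval x f = 1 ->
  forall i, i < N -> tact i f = i.
Proof.
pose K : set (free_group n) := fun f => forall i, i < N -> tact i f = i.
move/presR.2 => h; apply: (h K); split; last first.
  by move=> _ [r rR <-] i iN; rewrite tact_wfree // relator_fixes.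
have KV f' : K f' -> K f'^-1 by move=> hf i iN; rewrite -{1}(hf i iN) tact_winv.
split; [split|] => [//|f1 f2 h1 h2 i iN|f1 f2 h1 i iN].
  by rewrite [fword _]/= tact_wmul // h1 // KV.
rewrite [fword _]/= tact_wmul ?tact_wmul ?h1 //; first last.
- by apply: tact_ltn.
- by apply: tact_ltn.
by rewrite -{2}[fword f2]winvK tact_winv.
Qed.

Lemma tact_weval i (u v : word n) : i < N -> weval x u = weval x v ->
  tact i u = tact i v.
Proof.
move=> iN huv; pose f := weval (@fgen n) (u ++ winv v).
have hf : weval x f = 1 by rewrite weval_weval weval_cat weval_winv huv mulgV.
have := kernel_fixes hf iN; rewrite tact_wfree // tact_cat => hi.
by rewrite -[in RHS]hi -{2}[v]winvK tact_winv // tact_ltn.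
Qed.

Lemma tact_reval i (w : word n) : i < N ->
  raw_eval x (nth [::] ts i) * weval x w = raw_eval x (nth [::] ts (tact i w)).
Proof.
elim: w i => [|l w IH] i iN; first by rewrite weval_nil mulg1.
have /and3P[h1 _ /(derivable_sound relator_trivial)] := check_letterP l iN.
rewrite raw_eval_cat raw_eval_cons raw_eval_nil mulg1 => h2.
rewrite weval_cons mulgA -[leval x l]mulg1 -(weval_nil x) -weval_cons.
rewrite -raw_eval_erase raw_eval_cons raw_eval_nil mulg1 h2.
exact: IH.
Qed.

(** The label of the point [0] need not be trivial; it cancels. Together with [tact_weval] this
    makes the orbit of [0] a regular orbit of [H]. *)
Lemma tact_inj (u v : word n) : tact 0 u = tact 0 v -> weval x u = weval x v.
Proof.
move=> h; apply: (mulgI (raw_eval x (nth [::] ts 0))).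
by rewrite !tact_reval // h.
Qed.

Lemma presents_word : {wd : H -> word n | forall h, weval x (wd h) = h}.
Proof. by apply: cid; have [f hf] := choice presR.1; exists f. Qed.

Definition point_of (h : H) : nat := tact 0 (sval presents_word h).

Lemma tact_point (w : word n) : tact 0 w = point_of (weval x w).
Proof. by apply: tact_weval => //; rewrite (svalP presents_word). Qed.

Lemma point_inj : injective point_of.
Proof. by move=> g h /tact_inj; rewrite !(svalP presents_word). Qed.

Lemma point1 : point_of 1 = 0.
Proof. by rewrite -(weval_nil x) -tact_point. Qed.

Lemma point_ltn h : point_of h < N.
Proof. exact: tact_ltn. Qed.

Lemma tact_pointM h (w : word n) : tact (point_of h) w = point_of (h * weval x w).
Proof. by rewrite /point_of -tact_cat tact_point weval_cat (svalP presents_word). Qed.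

(** The table may have points outside the orbit of [0]. Only this inequality is required, since
    longer words merely add true relators. *)
Lemma card_leq_size : #|H| <= N.
Proof.
have inj : injective (fun h => Ordinal (point_ltn h)).
  by move=> g h /(congr1 val)/point_inj.
by have := leq_card _ inj; rewrite card_ord.
Qed.

Lemma valid_pos_word (w : seq nat) : all (fun j => j < n) w ->
  exists u : word n, pos_word w = erase u.
Proof.
elim: w => [_|j w IH /= /andP[jn /IH[u ->]]]; first by exists [::].
by exists ((Ordinal jn, false) :: u).
Qed.

Definition gen_image (j : nat) : H := raw_eval x (pos_word (nth [::] ws j)).

Lemma ws_valid j : all (fun j => j < n) (nth [::] ws j).
Proof.
case/and3P: checked => _ _ /and3P[/allP hws _ _].
by have [jw|jw] := ltnP j (size ws); [apply/hws/mem_nth | rewrite nth_default].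
Qed.

Lemma point_gen h j :
  act_word tbl (point_of h) (pos_word (nth [::] ws j)) = point_of (h * gen_image j).
Proof.
have [u hu] := valid_pos_word (ws_valid j).
by rewrite /gen_image hu raw_eval_erase tact_pointM.
Qed.

(** A word in the candidate generators that moves [0] as [x i] does must be equal to [x i], by
    regularity of the orbit. *)
Lemma gen_image_generates : tuple_gen (fun j : 'I_e => gen_image j) = [set: H]%SET.
Proof.
apply/setP => h; rewrite inE; have [w <-] := presR.1 h.
suff hx i : x i \in tuple_gen (fun j : 'I_e => gen_image j).
  elim: w => [|l w IH]; first by rewrite weval_nil group1.
  by rewrite weval_cons groupM // /leval; case: l.2; rewrite ?groupV.
case/and3P: checked => _ _ /and3P[_ /allP hqs /allP/(_ (nat_of_ord i))].
rewrite mem_iota ltn_ord => /(_ isT)/hasP[q /hqs hq /eqP].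
have -> : act_word tbl 0 (subst ws q) = point_of (raw_eval x (subst ws q)).
  suff [u ->] : exists u : word n, subst ws q = erase u.
    by rewrite tact_point raw_eval_erase.
  rewrite /subst; elim: q {hq} => [|k q [u IH]]; first by exists [::].
  have [v hv] := valid_pos_word (ws_valid k); exists (v ++ u).
  by rewrite /= IH hv /erase map_cat.
rewrite -[act_letter _ _ _]/(tact 0 [:: (i, false)]) tact_point weval_cons weval_nil.
rewrite mulg1 => /point_inj; rewrite /leval /= => <-.
elim: q hq => [_|k q IH /= /andP[ke /IH hq]]; first by rewrite raw_eval_nil group1.
rewrite /subst /= raw_eval_cat groupM // mem_gen //.
by apply/imsetP; exists (Ordinal ke).
Qed.

End RegularAction.

(** * Vectors over the prime field as lists of numbers *)

Section Vectors.
Variables (p d : nat).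
Hypothesis p_prime : prime p.
Local Notation V := 'rV['F_p]_d.

(* Missing entries count as zeros, so that [[::]] represents the zero vector. *)
Definition represents_vec (a : seq nat) (v : V) : Prop :=
  size a <= d /\ forall k : 'I_d, nth 0 a k = v ord0 k.

Lemma represents_vec0 : represents_vec [::] 0%R.
Proof. by split=> // k; rewrite mxE nth_nil. Qed.

Lemma represents_vec_eq0 a v : represents_vec a v ->
  all (fun k => k == 0) a = (v == 0%R).
Proof.
move=> [sa ha]; apply/(all_nthP 0)/eqP => [h|v0 k ka].
  apply/rowP => k; apply: val_inj; rewrite /= -ha mxE.
  by have [ka|ka] := ltnP k (size a); [apply/eqP/h | rewrite nth_default].
by rewrite (ha (Ordinal (leq_trans ka sa))) v0 mxE.
Qed.

Lemma nat_Fp (a : 'F_p) m : (m%:R = a)%R -> m %% p = a.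
Proof. by move=> <-; rewrite val_Fp_nat. Qed.

Lemma nth_map_iota (f : nat -> nat) (k : 'I_d) :
  nth 0 [seq f j | j <- iota 0 d] k = f k.
Proof. by rewrite (nth_map 0) ?size_iota // nth_iota. Qed.

Lemma represents_vadd a b u v : represents_vec a u -> represents_vec b v ->
  represents_vec (vadd p d a b) (u + v)%R.
Proof.
move=> [_ ha] [_ hb]; split=> [|k]; first by rewrite size_map size_iota.
rewrite nth_map_iota ha hb; apply: nat_Fp.
by rewrite natrD !natr_Zp mxE.
Qed.

Lemma nth_raw_mx m n (A : 'M['F_p]_(m, n)) (i : 'I_m) (j : 'I_n) :
  nth 0 (nth [::] (raw_mx A) i) j = A i j.
Proof.
rewrite (nth_map i) ?size_enum_ord // (nth_map j) ?size_enum_ord //.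
by rewrite !nth_ord_enum.
Qed.

Lemma foldr_addn (f : nat -> nat) s :
  foldr (fun l t => f l + t) 0 s = \sum_(l <- s) f l.
Proof. by elim: s => [|l s IH]; rewrite ?big_nil // big_cons /= IH. Qed.

Lemma represents_vmul a u (A : 'M['F_p]_d) : represents_vec a u ->
  represents_vec (vmul p d a (raw_mx A)) (u *m A)%R.
Proof.
move=> [_ ha]; split=> [|k]; first by rewrite size_map size_iota.
rewrite nth_map_iota; apply: nat_Fp.
have := foldr_addn (fun l => (nth 0 a l * nth 0 (nth [::] (raw_mx A) l) k)%N) (iota 0 d).
rewrite /= => ->; rewrite -{1}[d]subn0 -/(index_iota 0 d) big_mkord natr_sum mxE.
by apply: eq_bigr => l _; rewrite natrM ha nth_raw_mx !natr_Zp.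
Qed.

Lemma represents_unitv (b : 'I_d) : represents_vec (unitv d b) (delta_mx ord0 b)%R.
Proof.
split=> [|k]; first by rewrite size_map size_iota.
rewrite (nth_map_iota (fun k => if k == b then 1 else 0)%N) mxE eqxx /=.
by rewrite val_eqE; case: eqP.
Qed.

Lemma represents_raw_row (v : V) : represents_vec (head [::] (raw_mx v)) v.
Proof.
have -> : head [::] (raw_mx v) = nth [::] (raw_mx v) (ord0 : 'I_1).
  by rewrite nth0.
split=> [|k]; last exact: nth_raw_mx.
by rewrite (nth_map ord0) ?size_enum_ord // size_map size_enum_ord.
Qed.

End Vectors.

(** * Correctness of the computed relators *)

Section Relators.
Variables (p d e n r : nat) (H : finGroupType) (x : 'I_n -> H) (R : seq (word n)).
Variable rV : mx_representation 'F_p [set: H]%G d.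
Hypotheses (p_prime : prime p) (e_gt0 : 0 < e) (d_gt0 : 0 < d).
Hypothesis presR : presents x R.
Variable cs : 'I_r -> cochain2 p d H.
Hypothesis cs_basis : H2_basis rV cs.
Variable tabs : 'I_r -> cochain_table n p d.
Hypothesis tabs_cs : forall i, represents_cochain x (tabs i) (cs i).
Variables (ts : seq raw_word) (tbl : seq (seq (nat * nat)))
  (ds : seq (seq (raw_word * raw_letter))) (ws qs : seq (seq nat)).
Hypothesis checked : check e n (map (@erase n) R) (ts, (tbl, (ds, (ws, qs)))).
Local Notation mats := [seq raw_mx (rV (x i)) | i <- enum 'I_n].
Local Notation raw_tabs := [seq raw_cochain (tabs j) | j <- enum 'I_r].
Local Notation pt := (point_of presR tbl).
Local Notation h0 := (fun j : 'I_e => gen_image x ws j).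
Local Notation I := ('I_r + 'I_e * 'I_d)%type.
Local Notation E := (extension (cover_family e cs_basis)).

Lemma represents_vact a v (w : seq nat) : all (fun j => j < n) w ->
  represents_vec a v ->
  represents_vec (vact p d mats a w) (v *m rV (raw_eval x (pos_word w)))%R.
Proof.
elim: w a v => [|j w IH] a v /=.
  by move=> _; rewrite raw_eval_nil repr_mx1T mulmx1.
move=> /andP[jn wn] av; rewrite raw_eval_cons repr_mxMT mulmxA.
apply: IH => //; rewrite /raw_leval /= -[j]/(val (Ordinal jn)) raw_gen_ord.
rewrite (nth_map (Ordinal jn)) ?size_enum_ord // nth_ord_enum.
exact: represents_vmul.
Qed.

Lemma represents_lookup i g h :
  represents_vec (lookup tbl (raw_cochain (tabs i)) (pt g) (pt h)) (cs i (g, h)).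
Proof.
rewrite /lookup; set a := (fun y : raw_word * _ => _ && _).
have [t1 t2] := tabs_cs i.
have hasa : has a (raw_cochain (tabs i)).
  have [u [v [hu hv uv]]] := t2 g h; apply/hasP.
  exists (erase u, (erase v, (raw_mx (cs i (g, h)), tt))).
    by apply/mapP; exists (u, v, cs i (g, h)).
  by rewrite /a /= !(tact_point presR checked) hu hv !eqxx.
have := hasa; rewrite has_filter; set s := filter _ _ => s0.
have : head ([::], ([::], ([::], tt))) s \in s by case: s s0 => // y s _; rewrite mem_head.
rewrite mem_filter => /andP[+ /mapP[[[u v] b] uvb sE]]; rewrite sE.
rewrite /a /= !(tact_point presR checked) => /andP[/eqP hu /eqP hv].
have /(point_inj checked) <- := hu; have /(point_inj checked) <- := hv.
rewrite (t1 _ _ _ uvb); exact: represents_raw_row.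
Qed.

Definition raw_coordinate (i : I) : raw_table * (nat * nat) :=
  match i with
  | inl j => (raw_cochain (tabs j), (e, 0))
  | inr jb => ([::], (nat_of_ord jb.1, nat_of_ord jb.2))
  end.

Lemma all_coordinates (a : pred (raw_table * (nat * nat))) :
  all a (coordinates e d raw_tabs) <-> forall i, a (raw_coordinate i).
Proof.
rewrite /coordinates all_cat; split=> [/andP[h1 h2] [j|[j b]]|h].
- move/allP: h1; apply; apply/mapP; exists (raw_cochain (tabs j)) => //.
  by apply/mapP; exists j; rewrite ?mem_enum.
- move/allP: h2; apply; apply/flattenP.
  exists [seq ([::], (nat_of_ord j, b)) | b <- iota 0 d].
    by apply/mapP; exists (nat_of_ord j); rewrite // mem_iota ltn_ord.
  by apply/mapP; exists (nat_of_ord b); rewrite // mem_iota ltn_ord.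
apply/andP; split; apply/allP.
  by move=> _ /mapP[_ /mapP[j _ ->] ->]; exact: (h (inl j)).
move=> y /flattenP[_ /mapP[j + ->] /mapP[b + ->]].
rewrite !mem_iota !add0n /= => je bd.
exact: (h (inr (Ordinal je, Ordinal bd))).
Qed.

Definition represents_state i (s : nat * seq nat) (y : E) : Prop :=
  s.1 = pt y.1 /\ represents_vec s.2 (y.2 i).

Lemma represents_step i s y (j : 'I_e) : represents_state i s y ->
  represents_state i (step p d mats tbl ws (raw_coordinate i) s j)
    (y * cover_gen cs_basis h0 j).
Proof.
move=> [h1 h2]; split; first by rewrite /= h1 (point_gen presR checked).
rewrite /= !ffunE [in X in represents_vec _ X]GRing.addrAC /= h1.
have -> : act_word tbl 0 (pos_word (nth [::] ws j)) = pt (gen_image x ws j).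
  by have := point_gen presR checked 1 j; rewrite (point1 presR checked) mul1g.
apply: represents_vadd => //; first apply: represents_vadd => //.
- by apply: represents_vact => //; exact: (ws_valid checked).
- case: i {h2} => [i|jb] /=; first exact: represents_lookup.
  by rewrite /lookup ffunE; exact: represents_vec0.
case: i {h2} => [i|[j' b]] /=.
  (* Cocycle coordinates carry the generator index [e], which is out of range, so their vector part
     is always zero. *)
  by rewrite ltn_eqF //; exact: represents_vec0.
rewrite val_eqE; case: eqP => _; [exact: represents_unitv | exact: represents_vec0].
Qed.

Lemma represents_run i (w : seq 'I_e) :
  represents_state i (run p d mats tbl ws (raw_coordinate i) (map val w))
    (((1, 0%R) : E) * weval (cover_gen cs_basis h0) (positive w)).
Proof.
elim/last_ind: w => [|w j IH].
  rewrite weval_nil mulg1; split; first by rewrite (point1 presR checked).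
  by rewrite /= ffunE; exact: represents_vec0.
rewrite /positive !map_rcons /run -!cats1 foldl_cat weval_cat weval_cons weval_nil.
by rewrite mulg1 mulgA; apply: represents_step.
Qed.

Lemma is_trivialP (w : seq 'I_e) :
  is_trivial e p d mats raw_tabs tbl ws (map val w) <->
  weval (cover_gen cs_basis h0) (positive w) = 1.
Proof.
set g := weval _ _; rewrite /is_trivial; rewrite all_coordinates.
split=> [h|g1 i]; last first.
  have [-> /represents_vec_eq0 ->] := represents_run i w; rewrite -/g g1 mulg1 /=.
  by rewrite (point1 presR checked) ffunE !eqxx.
(* The run computes [(1, 0) * g], so [(1, 0)] has to be cancelled on the left. *)
apply: (mulgI ((1, 0%R) : E)); rewrite mulg1.
have coord i : (((1, 0%R) : E) * g).1 = 1 /\ (((1, 0%R) : E) * g).2 i = 0%R.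
  have [h1 /represents_vec_eq0 h2] := represents_run i w.
  have /andP[/eqP h3] := h i; rewrite h2 => /eqP h4; split=> //.
  apply: (point_inj (presR := presR) checked); apply: etrans (esym h1) _.
  by rewrite h3 (point1 presR checked).
(* The [H]-component is tested inside each coordinate, so one coordinate must exist; positivity of
   [e] and [d] provides it. *)
have [c1 _] := coord (inr (Ordinal e_gt0, Ordinal d_gt0)).
rewrite [LHS]surjective_pairing c1; congr pair.
by apply/ffunP => i; rewrite (coord i).2 ffunE.
Qed.

Lemma mem_words B (w : seq nat) :
  (w \in words e B) = (size w <= B) && all (fun j => j < e) w.
Proof.
elim: B w => [|B IH] w; first by rewrite inE; case: w.
rewrite /words iterS -/(words e B) inE; case: w => [|j w] //=.
rewrite ltnS; apply/flattenP/andP => [[_ /mapP[j' + ->] /mapP[w' + [-> ->]]]|].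
  by rewrite mem_iota add0n IH /= => -> /andP[-> ->].
move=> [wB /andP[je we]]; exists [seq j :: w | w <- words e B].
  by apply/mapP; exists j; rewrite // mem_iota.
by rewrite map_f // IH wB we.
Qed.

(** The typed form of [relators]. The default of [insubd] never occurs, as [words e] only uses
    letters below [e]. *)
Definition cover_relators : seq (word e) :=
  [seq positive (map (insubd (Ordinal e_gt0)) w)
  | w <- words e (bound e p d raw_tabs ts)
    & is_trivial e p d mats raw_tabs tbl ws w].

Lemma insubdK_seq (w : seq nat) : all (fun j => j < e) w ->
  map val (map (insubd (Ordinal e_gt0)) w) = w.
Proof.
elim: w => //= j w IH /andP[je we]; rewrite IH //; congr (_ :: _).
exact: insubdK.
Qed.

Lemma erase_cover_relators :
  map (@erase e) cover_relators = relators e p d mats raw_tabs ts tbl ws.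
Proof.
rewrite /cover_relators /relators -map_comp; apply/eq_in_map => w.
rewrite mem_filter mem_words => /andP[_ /andP[_ we]].
rewrite -{2}(insubdK_seq we) /= /erase /positive /pos_word -!map_comp.
exact: eq_map.
Qed.

Hypothesis irrV : mx_irreducible rV.

Theorem cover_relators_present (psi : {multiplicative free_group e -> H}) :
  (forall h, exists f, psi f = h) ->
  presents_group (Tagged (fun n => seq (word n)) cover_relators) (Vcover rV psi).
Proof.
apply: (cover_presentation p_prime irrV (cs_basis := cs_basis)
  (B := bound e p d raw_tabs ts) (h0 := h0)).
- exact: (gen_image_generates presR checked).
- rewrite /bound size_map size_enum_ord leq_mul2r.
  by rewrite (card_leq_size presR checked) orbT.
- move=> w wB hw; apply/mapP; exists (map val w).
    rewrite mem_filter; apply/andP; split; first exact/is_trivialP.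
    rewrite mem_words size_map wB; apply/allP => _ /mapP[j _ ->]; exact: ltn_ord.
  congr positive; apply: (inj_map val_inj); rewrite insubdK_seq //.
  by apply/allP => _ /mapP[j _ ->]; exact: ltn_ord.
- move=> _ /mapP[w + ->]; rewrite mem_filter mem_words => /andP[hw /andP[_ we]].
  by apply/is_trivialP; rewrite insubdK_seq.
Qed.

End Relators.

(** A nonempty subset of a finite group closed under products is a subgroup, so inverses can be
    avoided. *)
Lemma positive_word_of m (G : finGroupType) (z : 'I_m -> G) g :
  g \in tuple_gen z -> exists w : seq 'I_m, weval z (positive w) = g.
Proof.
pose S := [set g | `[< exists w : seq 'I_m, weval z (positive w) = g >]]%SET.
have gS : group_set S.
  apply/group_setP; split; first by rewrite inE; apply/asboolP; exists [::]; rewrite weval_nil.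
  move=> a b; rewrite !inE => -[u <-] [v <-].
  by exists (u ++ v); rewrite /positive map_cat weval_cat.
have /fintype.subsetP sub : tuple_gen z \subset S.
  rewrite (gen_subG _ (Group gS)); apply/fintype.subsetP => _ /imsetP[i _ ->].
  rewrite inE; apply/asboolP; exists [:: i].
  by rewrite weval_cons weval_nil mulg1.
by move/sub; rewrite inE => /asboolP.
Qed.

(** * Existence of a certificate *)

Section Completeness.
Variables (n e : nat) (H : finGroupType) (x : 'I_n -> H) (R : seq (word n)).
Hypothesis presR : presents x R.
Local Notation F := (free_group n).

Definition relator_at k : word n := nth [::] R k.

Definition conjugate_word (c : word n * (nat * bool)) : word n :=
  winv c.1 ++ ((if c.2.2 then winv (relator_at c.2.1) else relator_at c.2.1) ++ c.1).

Definition conjugate_elt (c : word n * (nat * bool)) : F :=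
  weval (@fgen n) (conjugate_word c).

Lemma conjugate_eltE c : conjugate_elt c =
  (if c.2.2 then (weval (@fgen n) (relator_at c.2.1))^-1
   else weval (@fgen n) (relator_at c.2.1)) ^ (weval (@fgen n) c.1).
Proof.
rewrite /conjugate_elt /conjugate_word !weval_cat weval_winv /conjg.
by case: c.2.2; rewrite ?weval_winv.
Qed.

Definition derivable_elt (f : F) :=
  exists D : seq (word n * (nat * bool)), f = \prod_(c <- D) conjugate_elt c.

(** Products of conjugates of relators and their inverses form a normal subgroup: inversion reverses
    the list and flips the signs, conjugation extends the conjugating words. *)
Lemma normal_closure_derivable (f : F) :
  normal_closure [set weval (@fgen n) r | r in [set` R]]%classic f ->
  derivable_elt f.
Proof.
have dM a b : derivable_elt a -> derivable_elt b -> derivable_elt (a * b).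
  by move=> [D ->] [D' ->]; exists (D ++ D'); rewrite big_cat.
move=> h; apply: (h (derivable_elt : set F)); split; last first.
  move=> _ [r rR <-]; exists [:: ([::], (index r R, false))].
  rewrite big_seq1 conjugate_eltE /= /relator_at nth_index // weval_nil.
  by rewrite conjg1.
split; first split.
- by exists [::]; rewrite big_nil.
- move=> a b da [D ->]; apply: dM => //.
  exists (rev [seq (c.1, (c.2.1, ~~ c.2.2)) | c <- D]).
  elim: D => [|c D IH]; first by rewrite !big_nil invg1.
  rewrite map_cons rev_cons -cats1 big_cat big_seq1 big_cons invgM IH /=.
  congr (_ * _); rewrite !conjugate_eltE /= -conjVg.
  by case: c.2.2 => /=; rewrite ?invgK.
- move=> a b [D ->]; exists [seq (c.1 ++ fword b, c.2) | c <- D].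
  elim: D => [|c D IH]; first by rewrite !big_nil conj1g.
  rewrite map_cons !big_cons conjMg IH; congr (_ * _).
  by rewrite !conjugate_eltE /= weval_cat weval_fgenK conjgM.
Qed.

Lemma consequence_erase (D : seq (word n * (nat * bool))) :
  consequence (map (@erase n) R) [seq (erase c.1, c.2) | c <- D] =
  erase (flatten (map conjugate_word D)).
Proof.
rewrite /consequence; elim: D => //= c D ->.
rewrite /conjugate_word /erase !map_cat -!/(erase _) raw_winv_erase.
have -> : nth [::] (map (@erase n) R) c.2.1 = erase (relator_at c.2.1).
  rewrite /relator_at; have [cR|cR] := ltnP c.2.1 (size R).
    by rewrite (nth_map [::]).
  by rewrite !nth_default ?size_map.
by rewrite raw_winv_erase; case: c.2.2; rewrite !catA.
Qed.

Lemma derivation_exists (u v : word n) : weval x u = weval x v ->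
  exists D, nilp (free_reduce (consequence (map (@erase n) R) D ++
                               (erase u ++ raw_winv (erase v)))).
Proof.
(* This is the inverse of [u v^-1], so a product of conjugates equal to it followed by [u v^-1]
   reduces to the empty word. *)
move=> huv; pose f := weval (@fgen n) (v ++ winv u).
have : weval x f = 1 by rewrite weval_weval weval_cat weval_winv huv mulgV.
move/presR.2/normal_closure_derivable => -[D fD].
exists [seq (erase c.1, c.2) | c <- D].
rewrite consequence_erase raw_winv_erase.
have -> (w1 w2 w3 : word n) : erase w1 ++ (erase w2 ++ erase w3) =
    erase (w1 ++ (w2 ++ w3)) by rewrite /erase !map_cat.
rewrite free_reduce_erase -weval_free !weval_cat.
have -> : weval (@fgen n) (flatten (map conjugate_word D)) = f.
  rewrite fD; elim: (D) => [|c D' IH]; first by rewrite big_nil weval_nil.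
  by rewrite /= weval_cat IH big_cons.
by rewrite /f weval_cat !weval_winv mulgA mulgKV mulgV.
Qed.

Hypothesis genH : generated_by e H.

(** Points are the ranks of the elements of [H], acted on by right multiplication and labelled by
    chosen words; the pool has one derivation for each element and letter. *)
Theorem certificate_exists :
  exists c : certificate, check e n (map (@erase n) R) c.
Proof.
have [wd hwd] := choice presR.1.
have [t gent] := genH.
have genx : tuple_gen x = [set: H]%SET.
  apply/setP => h; rewrite inE; apply/tuple_genP; have [w <-] := presR.1 h.
  by exists (weval (@fgen n) w); rewrite weval_weval.
have /fin_all_exists[W hW] (j : 'I_e) : exists w : seq 'I_n, weval x (positive w) = t j.
  by apply: positive_word_of; rewrite genx inE.
have /fin_all_exists[Q hQ] (i : 'I_n) : exists w : seq 'I_e, weval t (positive w) = x i.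
  by apply: positive_word_of; rewrite /tuple_gen gent inE.
pose rk (h : H) : nat := enum_rank h.
pose ts := [seq erase (wd h) | h <- enum H].
pose tbl := [seq [seq (rk (h * x j), rk (h * (x j)^-1)) | j <- enum 'I_n] | h <- enum H].
have /fin_all_exists[D hD] (hl : H * ('I_n * bool)) : exists D,
    nilp (free_reduce (consequence (map (@erase n) R) D ++
      (erase (wd hl.1 ++ [:: hl.2]) ++
       raw_winv (erase (wd (hl.1 * leval x hl.2)))))).
  apply: derivation_exists; rewrite weval_cat !hwd weval_cons weval_nil.
  by rewrite mulg1.
pose ds := [seq D hl | hl <- enum {: H * ('I_n * bool)}].
pose ws := [seq map val (W j) | j <- enum 'I_e].
pose qs := [seq map val (Q i) | i <- enum 'I_n].
have rk_lt h : rk h < size (enum H) by rewrite -cardE ltn_ord.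
have nth_rk h : nth h (enum H) (rk h) = h by exact: nth_enum_rank.
have sts : size ts = #|H| by rewrite size_map -cardE.
have actE h (l : letter n) : act_letter tbl (rk h) (nat_of_ord l.1, l.2) = rk (h * leval x l).
  rewrite /act_letter /= (nth_map h) // nth_rk.
  rewrite (nth_map l.1) ?size_enum_ord // nth_ord_enum /leval.
  by case: l.2.
have tactE h (w : word n) : act_word tbl (rk h) (erase w) = rk (h * weval x w).
  elim: w h => [|l w IH] h; first by rewrite weval_nil mulg1.
  by rewrite weval_cons mulgA -IH -actE.
have tsE h : nth [::] ts (rk h) = erase (wd h).
  by rewrite (nth_map h) // nth_rk.
have letter_ok h (l : letter n) :
    check_letter (map (@erase n) R) ts tbl ds (rk h) (nat_of_ord l.1, l.2).
  apply/and3P; rewrite actE; split; first by rewrite sts ltn_ord.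
    have := actE (h * leval x l) (linv l); rewrite /= => ->.
    by rewrite leval_linv mulgK.
  rewrite !tsE; apply/hasP; exists (D (h, l)); first by rewrite map_f // mem_enum.
  by have := hD (h, l); rewrite /= /erase map_cat.
have rkP i : i < #|H| -> exists h, i = rk h.
  by move=> iH; exists (enum_val (Ordinal iH)); rewrite /rk enum_valK.
have H0 : 0 < #|H| by apply/card_gt0P; exists 1.
exists (ts, (tbl, (ds, (ws, qs)))); apply/and3P; split=> /=; first by rewrite sts.
  apply/allP => i; rewrite mem_iota sts => /rkP[h ->]; apply/andP; split.
    apply/allP => _ /mapP[r rR ->].
    by rewrite tactE (relator_trivial presR) // mulg1.
  apply/allP => j; rewrite mem_iota add0n => /= jn.
  by rewrite !(letter_ok h (Ordinal jn, _)).
have wsE (j : 'I_e) : nth [::] ws j = map val (W j).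
  by rewrite (nth_map j) ?size_enum_ord // nth_ord_enum.
have pos_erase m (w : seq 'I_m) : pos_word (map val w) = erase (positive w).
  by rewrite /pos_word /erase /positive -!map_comp.
(* The element of rank [0] need not be the identity; both words compared below act from it. *)
have [h0 h0E] := rkP 0 H0.
apply/and3P; split.
- apply/allP => _ /mapP[j _ ->]; apply/allP => _ /mapP[i _ ->]; exact: ltn_ord.
- apply/allP => _ /mapP[j _ ->]; apply/allP => _ /mapP[i _ ->]; exact: ltn_ord.
apply/allP => i; rewrite mem_iota add0n /= => jn.
pose i' := Ordinal jn; apply/hasP; exists (map val (Q i')).
  by apply/mapP; exists i'; rewrite ?mem_enum.
have -> : subst ws (map val (Q i')) = erase (flatten [seq positive (W k) | k <- Q i']).
  rewrite /subst /erase map_flatten -!map_comp; congr flatten; apply: eq_map => k.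
  by rewrite /= wsE pos_erase.
rewrite h0E tactE -[i]/(nat_of_ord (i', false).1) actE.
have -> : weval x (flatten [seq positive (W k) | k <- Q i']) = weval t (positive (Q i')).
  elim: (Q i') => [|k q IH]; first by rewrite !weval_nil.
  by rewrite /= weval_cat hW IH weval_cons.
by rewrite hQ.
Qed.

End Completeness.

Theorem theorem1p3 :
  exists alg : prog,
  forall (e p : nat) (H : finGroupType) (n : nat) (x : 'I_n -> H)
    (R : seq (word n)) (d : nat) (rV : mx_representation 'F_p [set: H]%G d)
    (r : nat) (cs : 'I_r -> cochain2 p d H) (ts : 'I_r -> cochain_table n p d),
    0 < e -> prime p -> generated_by e H -> presents x R ->
    mx_irreducible rV -> H2_basis rV cs ->
    (forall i, represents_cochain x (ts i) (cs i)) ->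
    exists out : presentation,
      eval alg (enc_input e p R (fun i => rV (x i)) ts) (enc_presentation out) /\
      forall psi : {multiplicative free_group e -> H},
        (forall h : H, exists f : free_group e, psi f = h) ->
        presents_group out (Vcover rV psi).
Proof.
have [P hP] : exists P, forall z : input,
    (exists c : certificate, check z.1 z.2.2.1.1 z.2.2.1.2 c) ->
    exists2 c : certificate, check z.1 z.2.2.1.1 z.2.2.1.2 c &
      eval P (code z) (code (z, c)).
  exact: computable_search computable_check.
have [Q hQ] := computable_output.
exists (PSeq P Q) => e p H n x R d rV r cs ts e0 pp genH presR irrV basis tabs.
(* Irreducible modules are nonzero, which secures a coordinate for the triviality test. *)
have d0 : 0 < d by case/mx_irrP: irrV.
have [|[reps [tbl [ds [ws qs]]]] checked evalP] :=
  hP (raw_input e R (fun i => rV (x i)) ts).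
  exact: (certificate_exists presR genH).
(* The presentation depends on the certificate the search happened to find, and is fixed before
   [psi] is given. *)
exists (Tagged (fun n => seq (word n))
  (cover_relators x rV e0 ts reps tbl ws)); split.
  rewrite enc_inputE enc_presentationE; apply: ESeq evalP _.
  have := hQ (raw_input e R (fun i => rV (x i)) ts, (reps, (tbl, (ds, (ws, qs))))).
  by rewrite /output /= erase_cover_relators.
exact: (cover_relators_present pp e0 d0 presR basis tabs checked irrV).
Qed.
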